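(* Let $\pi\colon E\to M$ be a vector bundle endowed with a (generally nonlinear) connection, with connector map $\kappa$ and horizontal and vertical projectors $P_H,P_V$. Then the map $D\colon \mathfrak{X}(E)\times\operatorname{Sec}(\pi^*E)\to\operatorname{Sec}(\pi^*E)$ given by $$D_U\sigma=\kappa\bigl([P_H(U),\sigma^V]\bigr)+\kappa\bigl(T\sigma(P_V(U))\bigr)$$ is a covariant derivative on the vector bundle $\mathrm{pr}_1\colon\pi^*E\to E$; that is, $D$ is $\mathbb{R}$-bilinear and satisfies $D_{fU}\sigma=fD_U\sigma$ and $D_U(f\sigma)=U(f)\sigma+fD_U\sigma$ for all $f\in C^\infty(E)$, $U\in\mathfrak{X}(E)$, $\sigma\in\operatorname{Sec}(\pi^*E)$.
   Context: All objects are $C^\infty$. $\pi\colon E\to M$ is a real vector bundle of finite rank. The pullback bundle $\pi^*E=\{(a,b)\in E\times E:\pi(a)=\pi(b)\}$, with projection $\mathrm{pr}_1(a,b)=a$, is a vector bundle over $E$; its sections are identified with maps $\sigma\colon E\to E$ with $\pi\circ\sigma=\pi$. Similarly $\pi^*TM=\{(a,v)\in E\times TM:\pi(a)=\tau_M(v)\}\to E$, where $\tau_M\colon TM\to M$ is the projection. Vertical lift: $\xi^V\colon\pi^*E\to TE$, $\xi^V(a,b)=\frac{d}{ds}(a+sb)|_{s=0}$; for $\sigma\in\operatorname{Sec}(\pi^*E)$, $\sigma^V\in\mathfrak{X}(E)$ is the vector field $\sigma^V(a)=\xi^V(a,\sigma(a))$. A connection on $E$ is a vector bundle morphism $\xi^H\colon\pi^*TM\to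 TE$ over $\mathrm{id}_E$ with $T\pi(\xi^H(a,v))=v$ (no linearity in $a$ is required). The connector $\kappa\colon TE\to\pi^*E$ is the unique vector bundle morphism over $\mathrm{id}_E$ with $\kappa\circ\xi^V=\mathrm{id}$ and $\kappa\circ\xi^H=0$. The projectors are $P_V=\xi^V\circ\kappa$ and $P_H=\mathrm{id}_{TE}-P_V$ (so $P_H(W)=\xi^H(a,T\pi(W))$ for $W\in T_aE$). For $\sigma\in\operatorname{Sec}(\pi^*E)$, viewed as a map $E\to E$, and $W$ a vertical vector field on $E$, the vector $T_a\sigma(W_a)\in T_{\sigma(a)}E$ is vertical, and $\kappa(T\sigma(W))$ denotes the section of $\pi^*E$ whose value at $a$ is the $E_{\pi(a)}$-component of $\kappa(T_a\sigma(W_a))$ (i.e. the ordinary derivative in the direction $W_a$ of $\sigma$ restricted to the fibre $E_{\pi(a)}$). *)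

(* Defs.v *)
From HB Require Import structures.
From mathcomp Require Import all_boot all_order all_algebra.
From mathcomp Require Import all_classical all_reals all_analysis.

Set Implicit Arguments.
Unset Strict Implicit.
Unset Printing Implicit Defensive.

Import Order.TTheory GRing.Theory Num.Theory.
Import numFieldNormedType.Exports.
Local Open Scope classical_set_scope.
Local Open Scope ring_scope.

(* f is C^j on the open set A.  The model spaces V, W used below are finite
   dimensional, so asking the maps x |-> df_x(v) to be C^(j-1) for every v is the
   same as asking this of df : A -> Hom(V, W). *)
Fixpoint Ck (R : realType) (V W : normedModType R) (j : nat) (A : set V)
    (f : V -> W) : Prop :=
  match j with
  | 0 => forall x, A x -> {for x, continuous f}
  | j'.+1 => (forall x, A x -> differentiable f x) /\
             (forall v : V, Ck j' A (fun x => 'd f x v))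
  end.

Definition smooth_on (R : realType) (V W : normedModType R) (A : set V)
  (f : V -> W) : Prop := forall j, Ck j A f.

(* A chart is a bijection between cdom and cfun @` cdom; cfun and cinv are total
   functions, irrelevant outside these sets. *)
Record chart (R : realType) (X : Type) (V : normedModType R) := Chart {
  cdom : set X;
  cfun : X -> V;
  cinv : V -> X
}.

(* The data of an atlas.  The underlying set is the union of the chart domains,
   which may be smaller than the ambient type cpt (see tangent_bundle). *)
Record charted (R : realType) := Charted {
  cpt :> Type;
  cmodel : normedModType R;
  atlas : set (chart cpt cmodel)
}.

Definition carrier (R : realType) (X : charted R) : set X :=
  [set x | exists2 c, atlas c & cdom c x].

Definition smooth_atlas (R : realType) (X : charted R) : Prop :=
  (forall c : chart X (cmodel X), atlas c ->
     forall x, cdom c x -> cinv c (cfun c x) = x) /\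
  (forall c c' : chart X (cmodel X), atlas c -> atlas c' ->
     open (cfun c @` (cdom c `&` cdom c')) /\
     smooth_on (cfun c @` (cdom c `&` cdom c')) (cfun c' \o cinv c)).

(* F is smooth in a neighbourhood of x. *)
Definition smooth_at (R : realType) (X Y : charted R) (F : X -> Y) (x : X) :
    Prop :=
  carrier (F x) /\
  forall (c : chart X (cmodel X)) (c' : chart Y (cmodel Y)),
    atlas c -> atlas c' -> cdom c x -> cdom c' (F x) ->
    exists A : set (cmodel X),
      [/\ open A, A (cfun c x), A `<=` cfun c @` cdom c,
          forall y, A y -> cdom c' (F (cinv c y)) &
          smooth_on A (cfun c' \o F \o cinv c)].

Definition smooth_map (R : realType) (X Y : charted R) (F : X -> Y) : Prop :=
  forall x, carrier x -> smooth_at F x.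

Definition real_line (R : realType) : charted R :=
  @Charted R R R^o [set @Chart R R R^o setT id id].

Definition smooth_fun_at (R : realType) (X : charted R) (f : X -> R) (x : X) :
  Prop := @smooth_at R X (real_line R) f x.

Definition smooth_fun (R : realType) (X : charted R) (f : X -> R) : Prop :=
  @smooth_map R X (real_line R) f.

Record manifold (R : realType) (m : nat) := Manifold {
  mspace :> topologicalType;
  matlas : set (chart mspace 'rV[R]_m);
  mhausdorff : hausdorff_space mspace;
  msecond_countable : @second_countable mspace;
  mcover : forall x, exists2 c, matlas c & cdom c x;
  mhomeo : forall c, matlas c ->
    [/\ open (cdom c), {within cdom c, continuous (cfun c)} &
        {within cfun c @` cdom c, continuous (cinv c)}];
  msmooth : smooth_atlas (Charted matlas)
}.

Definition manifold_charted (R : realType) (m : nat) (M : manifold R m) :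
  charted R := Charted (@matlas R m M).

Coercion manifold_charted : manifold >-> charted.

(* Tangent vectors at p act as derivations on the functions defined and smooth
   near p.  They are represented by functionals on all functions X -> R, with
   value 0 on the functions that are not smooth near p, so that two tangent
   vectors at p are equal iff they agree on smooth germs. *)
Definition tvec (R : realType) (X : charted R) : lmodType R := (X -> R) -> R^o.

Definition at_germs (R : realType) (X : charted R) (p : X) (v : tvec X) :
  tvec X := fun f => if `[< smooth_fun_at f p >] then v f else 0.

(* \sum_i w_i d/dx^i at p, for the chart c = (x^1, ..., x^n). *)
Definition coord_tvec (R : realType) (X : charted R) (c : chart X (cmodel X))
  (p : X) (w : cmodel X) : tvec X :=
  at_germs p (fun f => 'd (f \o cinv c : cmodel X -> R^o) (cfun c p) w).

Definition tangent (R : realType) (X : charted R) (p : X) : set (tvec X) :=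
  [set v | exists c w, [/\ atlas c, cdom c p & v = coord_tvec c p w]].

Definition tcoord (R : realType) (X : charted R) (c : chart X (cmodel X))
  (p : X) (v : tvec X) : cmodel X := xget 0 [set w | coord_tvec c p w = v].

(* The total space TX = {(p, v) | v \in T_p X}. *)
Definition tangent_chart (R : realType) (X : charted R)
    (c : chart X (cmodel X)) :
    chart (X * tvec X)%type (cmodel X * cmodel X)%type :=
  Chart [set pv | cdom c pv.1 /\ tangent pv.1 pv.2]
    (fun pv => (cfun c pv.1, tcoord c pv.1 pv.2))
    (fun xw => (cinv c xw.1, coord_tvec c (cinv c xw.1) xw.2)).

Definition tangent_bundle (R : realType) (X : charted R) : charted R :=
  Charted [set tangent_chart c | c in @atlas R X].

(* The total space F^*TY = {(a, v) | a \in X, v \in T_(F a) Y}. *)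
Definition pullback_tangent_chart (R : realType) (X Y : charted R) (F : X -> Y)
    (c : chart X (cmodel X)) (c' : chart Y (cmodel Y)) :
    chart (X * tvec Y)%type (cmodel X * cmodel Y)%type :=
  Chart [set av | [/\ cdom c av.1, cdom c' (F av.1) & tangent (F av.1) av.2]]
    (fun av => (cfun c av.1, tcoord c' (F av.1) av.2))
    (fun xw => (cinv c xw.1, coord_tvec c' (F (cinv c xw.1)) xw.2)).

Definition pullback_tangent (R : realType) (X Y : charted R) (F : X -> Y) :
    charted R :=
  Charted [set t | exists c c',
    [/\ atlas c, atlas c' & t = pullback_tangent_chart F c c']].

Definition tangent_map (R : realType) (X Y : charted R) (F : X -> Y) (p : X)
  (v : tvec X) : tvec Y := at_germs (F p) (fun g => v (g \o F)).

Definition vector_field (R : realType) (X : charted R) (U : X -> tvec X) :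
  Prop := @smooth_map R X (tangent_bundle X) (fun p => (p, U p)).

Definition vf_apply (R : realType) (X : charted R) (U : X -> tvec X)
  (f : X -> R) : X -> R := fun p => U p f.

Definition lie_bracket (R : realType) (X : charted R) (U V : X -> tvec X) :
    X -> tvec X :=
  fun p => at_germs p (fun f => U p (vf_apply V f) - V p (vf_apply U f)).

(* tfun x, for x in tdom, is a linear isomorphism from the fibre at x to R^k,
   with inverse tinv x. *)
Record trivialization (R : realType) (X : Type) (G : X -> lmodType R)
    (k : nat) := Trivialization {
  tdom : set X;
  tfun : forall x, G x -> 'rV[R]_k;
  tinv : forall x, 'rV[R]_k -> G x
}.

(* The data of a vector bundle of rank k; the axioms are in vbundle. *)
Record vbundle_data (R : realType) (X : charted R) (k : nat) := VBundleData {
  fibre : X -> lmodType R;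
  trivs : set (trivialization fibre k)
}.

Definition total_chart (R : realType) (X : charted R) (k : nat)
    (B : vbundle_data X k) (c : chart X (cmodel X))
    (t : trivialization (fibre B) k) :
    chart {x : X & fibre B x} (cmodel X * 'rV[R]_k)%type :=
  Chart [set a | cdom c (tag a) /\ tdom t (tag a)]
    (fun a => (cfun c (tag a), tfun t (tagged a)))
    (fun xw => Tagged (fibre B) (tinv t (cinv c xw.1) xw.2)).

Definition total_space (R : realType) (X : charted R) (k : nat)
    (B : vbundle_data X k) : charted R :=
  Charted [set tc | exists c t,
    [/\ atlas c, trivs t & tc = total_chart (B := B) c t]].

Definition bproj (R : realType) (X : charted R) (k : nat)
  (B : vbundle_data X k) (a : total_space B) : X := tag a.

Definition bpoint (R : realType) (X : charted R) (k : nat)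
  (B : vbundle_data X k) (x : X) (b : fibre B x) : total_space B :=
  Tagged (fibre B) b.

(* The last axiom says that the induced charts turn the total space into a smooth
   manifold for which the trivializations are diffeomorphisms; equivalently, that
   the transition functions are smooth. *)
Record vbundle (R : realType) (m : nat) (M : manifold R m) (k : nat) :=
  VBundle {
  vbdata :> vbundle_data M k;
  vb_cover : forall x : M, exists2 t, @trivs R M k vbdata t & tdom t x;
  vb_open : forall t, @trivs R M k vbdata t -> open (tdom t : set M);
  vb_iso : forall t, @trivs R M k vbdata t -> forall x, tdom t x ->
    [/\ linear (@tfun _ _ _ _ t x), cancel (@tfun _ _ _ _ t x) (@tinv _ _ _ _ t x) &
        cancel (@tinv _ _ _ _ t x) (@tfun _ _ _ _ t x)];
  vb_smooth : smooth_atlas (total_space vbdata)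
}.

Definition pullback (R : realType) (X Y : charted R) (k : nat) (F : X -> Y)
    (B : vbundle_data Y k) : vbundle_data X k :=
  @VBundleData R X k (fun a => fibre B (F a))
    [set @Trivialization R X (fun a => fibre B (F a)) k
           (F @^-1` tdom t) (fun a => @tfun _ _ _ _ t (F a))
           (fun a => @tinv _ _ _ _ t (F a)) | t in @trivs R Y k B].

Definition section (R : realType) (X : charted R) (k : nat)
  (B : vbundle_data X k) (s : forall x, fibre B x) : Prop :=
  @smooth_map R X (total_space B) (fun x => bpoint (s x)).

Definition covariant_derivative (R : realType) (X : charted R) (k : nat)
    (B : vbundle_data X k)
    (D : (X -> tvec X) -> (forall x, fibre B x) -> (forall x, fibre B x)) :
    Prop :=
  [/\ forall U s, vector_field U -> section s -> section (D U s),
      forall (r : R) U V s, vector_field U -> vector_field V -> section s ->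
        forall x, D (fun p => r *: U p + V p) s x = r *: D U s x + D V s x,
      forall (r : R) U s t, vector_field U -> section s -> section t ->
        forall x, D U (fun p => r *: s p + t p) x = r *: D U s x + D U t x,
      forall f U s, smooth_fun f -> vector_field U -> section s ->
        forall x, D (fun p => f p *: U p) s x = f x *: D U s x &
      forall f U s, smooth_fun f -> vector_field U -> section s ->
        forall x, D U (fun p => f p *: s p) x =
                  vf_apply U f x *: s x + f x *: D U s x].

Definition linear_on (R : realType) (V W : lmodType R) (A : set V)
  (L : V -> W) : Prop :=
  forall r u v, A u -> A v -> L (r *: u + v) = r *: L u + L v.

(* xi^V(a, b) = d/ds (a + s b) at s = 0. *)
Definition vlift (R : realType) (X : charted R) (k : nat)
    (B : vbundle_data X k) (a : total_space B) (b : fibre B (bproj a)) :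
    tvec (total_space B) :=
  at_germs a (fun f =>
    derive1 (fun s : R => f (bpoint (tagged a + s *: b)) : R^o) 0).

(* A possibly nonlinear connection: no linearity in a is required. *)
Record connection (R : realType) (m : nat) (M : manifold R m) (k : nat)
    (E : vbundle M k) := Connection {
  hlift : total_space E -> tvec M -> tvec (total_space E);
  hlift_tangent : forall a v, tangent (bproj a) v -> tangent a (hlift a v);
  hlift_linear : forall a, linear_on (tangent (bproj a)) (hlift a);
  hlift_proj : forall a v, tangent (bproj a) v ->
    tangent_map (@bproj R M k E) a (hlift a v) = v;
  hlift_smooth :
    @smooth_map R (pullback_tangent (@bproj R M k E)) (tangent_bundle (total_space E))
      (fun av => (av.1, hlift av.1 av.2))
}.

Definition pullback_self (R : realType) (X : charted R) (k : nat)
  (B : vbundle_data X k) : vbundle_data (total_space B) k :=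
  pullback (@bproj R X k B) B.

Record connector (R : realType) (m : nat) (M : manifold R m) (k : nat)
    (E : vbundle M k) (H : connection E) := Connector {
  kappa : forall a : total_space E, tvec (total_space E) -> fibre E (bproj a);
  kappa_linear : forall a, linear_on (tangent a) (kappa a);
  kappa_smooth :
    @smooth_map R (tangent_bundle (total_space E)) (total_space (pullback_self E))
      (fun aW => @bpoint R (total_space E) k (pullback_self E) aW.1
                   (kappa aW.1 aW.2));
  kappa_vlift : forall a b, kappa a (vlift b) = b;
  kappa_hlift : forall a v, tangent (bproj a) v -> kappa a (hlift H a v) = 0
}.

Definition proj_V (R : realType) (m : nat) (M : manifold R m) (k : nat)
    (E : vbundle M k) (H : connection E) (K : connector H) (a : total_space E)
    (W : tvec (total_space E)) : tvec (total_space E) :=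
  vlift (kappa K a W).

Definition proj_H (R : realType) (m : nat) (M : manifold R m) (k : nat)
    (E : vbundle M k) (H : connection E) (K : connector H) (a : total_space E)
    (W : tvec (total_space E)) : tvec (total_space E) :=
  W - proj_V K a W.

(* A section of pi^*E seen as a map E -> E over the identity of M. *)
Definition section_map (R : realType) (m : nat) (M : manifold R m) (k : nat)
    (E : vbundle M k) (s : forall a : total_space E, fibre E (bproj a)) :
    total_space E -> total_space E :=
  fun a => bpoint (s a).

Definition vertical_field (R : realType) (m : nat) (M : manifold R m)
    (k : nat) (E : vbundle M k) (s : forall a : total_space E, fibre E (bproj a)) :
    total_space E -> tvec (total_space E) :=
  fun a => vlift (s a).

(* The second connector is taken at s(a), which lies in the same fibre as a. *)
Definition cov_D (R : realType) (m : nat) (M : manifold R m) (k : nat)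
    (E : vbundle M k) (H : connection E) (K : connector H)
    (U : total_space E -> tvec (total_space E))
    (s : forall a : total_space E, fibre E (bproj a)) (a : total_space E) :
    fibre E (bproj a) :=
  kappa K a (lie_bracket (fun a' => proj_H K a' (U a')) (vertical_field s) a) +
  kappa K (section_map s a) (tangent_map (section_map s) a (proj_V K a (U a))).

(* Main.v *)
Require Import Defs.
From mathcomp Require Import all_boot all_order all_algebra.
From mathcomp Require Import all_classical all_reals all_analysis.
From HB Require Import structures.
From mathcomp Require Import ring lra.

Set Implicit Arguments.
Unset Strict Implicit.
Unset Printing Implicit Defensive.

Import Order.TTheory GRing.Theory Num.Theory.
Import numFieldNormedType.Exports.
Local Open Scope classical_set_scope.
Local Open Scope ring_scope.

(** In a bundle chart a point of the total space has coordinates y = (x, e), a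
    section sigma of the pulled-back bundle is a vector-valued function S of y,
    its vertical field is (0, S), and the horizontal part P_H U of a field is a
    function u of y.  The tangent map of sigma sends a vertical vector (0, b)
    to the vertical vector (0, dS(0, b)) ([kappa_tangent_map]), and the bracket
    [P_H U, sigma^V] is d(0, S)(u) - du(0, S) ([lie_bracketE]).  At a fixed
    point kappa is linear in the coordinates of a tangent vector, it maps
    (0, w) to w and kills the horizontal vector u, and
      D_U sigma = kappa (d(0, S)(u) - du(0, S)) + dS(0, kappa U)
    ([cov_D_coord]).  Both calculation rules can be read off this formula.
    Replacing U by fU + V leaves in the bracket the non-tensorial term
    - df(0, S) u, which kappa kills ([cov_D_combl]).  Replacing S by fS + S'
    produces df(u) S from the bracket and df(0, kappa U) S from the second
    summand; their sum is df(U) S because U = P_H U + P_V U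
    ([cov_D_combr]).

    The bracket is defined as a commutator of derivations on germs of
    functions, whereas kappa is linear only on tangent vectors.  That the
    commutator is a tangent vector, with the coordinates above, means that the
    second derivatives of the test function cancel, that is, that they are
    symmetric ([diff2_sym]); both iterated derivatives are limits of the same
    second difference, by the mean value theorem.

    Smoothness of D_U sigma ([cov_D_section]) holds since the bracket of smooth
    fields is smooth, kappa is a smooth map of total spaces, and
    y |-> dS_y(0, kappa U) is smooth.  The last fact, like the chain rule for
    C^j functions, uses that the model spaces are finite-dimensional: expanding
    g(y) in a basis turns dS_y(g(y)) into a finite sum of products of smooth
    functions ([smooth_near_diff_app], [Ck_comp]). *)

(** * Rules of differentiation *)

Section Differentials.
Context {R : realType} {V W W' : normedModType R}.

(** The differential depends only on the germ: the expansion of f to first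
    order is also one of g, and such an expansion is unique. *)
Lemma near_eq_diff (f g : V -> W) x : (\forall z \near x, f z = g z) ->
  differentiable f x -> differentiable g x /\ 'd g x = 'd f x :> (V -> W).
Proof.
move=> fg df.
have gE : g \o shift x = cst (g x) + 'd f x +o_ 0 id.
  have := diff_locally df => dfE.
  apply/eqaddoP => _ /posnumP[e].
  move/eqaddoP: dfE => /(_ e%:num [elaborate gt0 e]) dfE.
  have fg0 : \forall h \near 0, f (h + x) = g (h + x).
    by move: fg; rewrite (near_shift 0 x) subr0.
  near=> h.
  have fgh : f (h + x) = g (h + x) by near: h.
  rewrite fctE /= -fgh -(nbhs_singleton fg).
  by near: h.
have ddf : 'd g x = 'd f x :> (V -> W).
  by apply: diff_unique => //; exact: diff_continuous.
split; last exact: ddf.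
apply/diff_locallyP; rewrite ddf; split; last exact: gE.
exact: diff_continuous.
Unshelve. all: by end_near. Qed.

Lemma diffD_app (f g : V -> W) x v : differentiable f x -> differentiable g x ->
  'd (fun z => f z + g z) x v = 'd f x v + 'd g x v.
Proof. by move=> df dg; have := congr1 (fun h => h v) (diffD df dg). Qed.

Lemma diff_comp_app (f : V -> W) (g : W -> W') x v :
  differentiable f x -> differentiable g (f x) ->
  'd (fun z => g (f z)) x v = 'd g (f x) ('d f x v).
Proof. by move=> df dg; have := congr1 (fun h => h v) (diff_comp df dg). Qed.

Lemma scale_is_bilinear :
  bilinear_for
    (GRing.Scale.Law.clone _ _ *:%R _) (GRing.Scale.Law.clone _ _ *:%R _)
    (fun (k : R^o) (w : W) => k *: w).
Proof.
split=> [u'|u] a x y /=; first by rewrite scalerDl scalerA.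
by rewrite scalerDr !scalerA mulrC.
Qed.

Lemma diff_scale (k : V -> R^o) (f : V -> W) x :
  differentiable k x -> differentiable f x ->
  differentiable (fun z => k z *: f z) x /\
  forall v, 'd (fun z => k z *: f z) x v = k x *: 'd f x v + 'd k x v *: f x.
Proof.
move=> dk df.
pose b : {bilinear R^o -> W -> W} :=
  HB.pack (fun (k : R^o) (w : W) => k *: w)
    (bilinear_isBilinear.Build R R^o W W _ _ _ scale_is_bilinear).
have bc : continuous (fun p : R^o * W => b p.1 p.2) by exact: scale_continuous.
have kfE : (fun z => k z *: f z) =
  (fun p : R^o * W => b p.1 p.2) \o (fun z => (k z, f z)) by [].
have dkf := differentiable_pair dk df.
have db : differentiable (fun p : R^o * W => b p.1 p.2) (k x, f x).
  exact: differentiable_bilin.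
rewrite kfE; split; first exact: differentiable_comp.
by move=> v; rewrite diff_comp// diff_bilin// diff_pair.
Qed.

End Differentials.

(** * Functions of class C^j on an open set *)

Section SmoothOn.
Context {R : realType}.
Implicit Types V W : normedModType R.

Lemma CkS V W j A (f : V -> W) : Ck j.+1 A f -> Ck j A f.
Proof.
elim: j f => [|j IH] f.
  by case=> df _ x Ax; exact/differentiable_continuous/df.
by case=> df Cdf; split=> // v; apply: IH.
Qed.

Lemma Ck_sub V W j (A B : set V) (f : V -> W) : A `<=` B -> Ck j B f -> Ck j A f.
Proof.
move=> AB; elim: j f => [|j IH] f; first by move=> Cf x Ax; exact/Cf/AB.
by case=> df Cdf; split=> [x Ax|v]; [exact/df/AB|exact: IH (Cdf v)].
Qed.

Lemma Ck_ext V W j (A : set V) (f g : V -> W) : open A ->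
  (forall x, A x -> f x = g x) -> Ck j A f -> Ck j A g.
Proof.
move=> oA; have nA x : A x -> \forall z \near x, A z by move=> Ax; exact: open_nbhs_nbhs.
elim: j f g => [|j IH] f g fg /=.
  move=> Cf x Ax; rewrite /prop_for /continuous_at -(fg _ Ax).
  apply: cvg_trans (Cf x Ax); apply: near_eq_cvg.
  by near=> z; apply: fg; near: z; exact: nA.
have fgn x : A x -> \forall z \near x, f z = g z.
  by move=> Ax; near=> z; apply: fg; near: z; exact: nA.
case=> df Cdf; split=> [x Ax|v]; first by case: (near_eq_diff (fgn _ Ax) (df _ Ax)).
by apply: IH (Cdf v) => x Ax; case: (near_eq_diff (fgn _ Ax) (df _ Ax)) => _ ->.
Unshelve. all: by end_near. Qed.

Lemma Ck_cst V W j (A : set V) (w : W) : Ck j A (fun=> w).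
Proof.
elim: j w => [|j IH] w; first by move=> x _; exact: cvg_cst.
split=> [x _|v]; first exact: differentiable_cst.
rewrite (_ : (fun x => _) = fun=> 0)//.
by apply/funext => x; rewrite (diff_cst w).
Qed.

Lemma CkD V W j (A : set V) (f g : V -> W) : open A ->
  Ck j A f -> Ck j A g -> Ck j A (fun x => f x + g x).
Proof.
move=> oA; elim: j f g => [|j IH] f g.
  by move=> Cf Cg x Ax; apply: continuousD; [exact: Cf|exact: Cg].
case=> df Cdf [dg Cdg]; split=> [x Ax|v].
  by apply: differentiableD; [exact: df|exact: dg].
apply: Ck_ext (IH _ _ (Cdf v) (Cdg v)) => // x Ax /=.
by rewrite diffD_app//; [exact: df|exact: dg].
Qed.

(** The Leibniz rule gives d(k f) = k df + dk f; in the induction on j the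
    undifferentiated factors are used only up to order j ([CkS]). *)
Lemma CkZ V W j (A : set V) (k : V -> R^o) (f : V -> W) : open A ->
  Ck j A k -> Ck j A f -> Ck j A (fun x => k x *: f x).
Proof.
move=> oA; elim: j k f => [|j IH] k f.
  by move=> Ck Cf x Ax; apply: continuousZ; [exact: Ck|exact: Cf].
move=> CSk CSf; have [dk Cdk] := CSk; have [df Cdf] := CSf.
split=> [x Ax|v]; first by have [] := diff_scale (dk _ Ax) (df _ Ax).
apply: Ck_ext (CkD oA (IH _ _ (CkS CSk) (Cdf v)) (IH _ _ (Cdk v) (CkS CSf))) => //.
by move=> x Ax; case: (diff_scale (dk _ Ax) (df _ Ax)) => _ ->.
Qed.

Lemma Ck_sum V W (I : finType) j (A : set V) (f : I -> V -> W) : open A ->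
  (forall i, Ck j A (f i)) -> Ck j A (fun x => \sum_i f i x).
Proof.
move=> oA Cf; elim: (index_enum I) => [|i s IH].
  by rewrite (_ : (fun _ => _) = fun=> 0); [exact: Ck_cst|apply/funext => x; rewrite big_nil].
rewrite (_ : (fun _ => _) = fun x => f i x + \sum_(i <- s) f i x); first exact: CkD.
by apply/funext => x; rewrite big_cons.
Qed.

Lemma Ck_lin_comp V W W' j (A : set V) (L : {linear W -> W'}) (f : V -> W) :
  open A -> continuous L -> Ck j A f -> Ck j A (fun x => L (f x)).
Proof.
move=> oA cL; have dL x : differentiable L x by exact: linear_differentiable.
elim: j f => [|j IH] f.
  by move=> Cf x Ax; apply: (@continuous_comp _ _ _ f L); [exact: Cf|exact: cL].
case=> df Cdf; split=> [x Ax|v].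
  by apply: (@differentiable_comp _ _ _ _ f L) => //; exact: df.
apply: Ck_ext (IH _ (Cdf v)) => // x Ax /=.
by rewrite (diff_comp (df _ Ax) (dL _)) /= diff_lin.
Qed.

Lemma Ck_id V j (A : set V) : Ck j A id.
Proof.
case: j => [|j]; first by move=> x _; exact: cvg_id.
have ci : continuous (idfun : V -> V) by move=> x; exact: cvg_id.
split=> [x _|v]; first exact: (linear_differentiable (f := idfun)).
rewrite (_ : (fun x => _) = fun=> v); first exact: Ck_cst.
by apply/funext => x; rewrite (diff_lin x ci).
Qed.

Lemma Ck_lin V W j (A : set V) (L : {linear V -> W}) : open A ->
  continuous L -> Ck j A L.
Proof. by move=> oA cL; exact: Ck_lin_comp (@Ck_id V j A). Qed.

Lemma Ck_pair V W W' j (A : set V) (f : V -> W) (g : V -> W') :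
  Ck j A f -> Ck j A g -> open A -> Ck j A (fun x => (f x, g x)).
Proof.
move=> + + oA; elim: j f g => [|j IH] f g.
  by move=> Cf Cg x Ax; apply: cvg_pair; [exact: Cf|exact: Cg].
case=> df Cdf [dg Cdg]; split=> [x Ax|v].
  by apply: differentiable_pair; [exact: df|exact: dg].
apply: Ck_ext (IH _ _ (Cdf v) (Cdg v)) => // x Ax.
by rewrite (diff_pair (df _ Ax) (dg _ Ax)).
Qed.

End SmoothOn.

(** Finite dimension is asked in the form of a basis with continuous
    coordinates, since it is used to expand a vector along smooth coefficients. *)
Definition findim (R : realType) (V : normedModType R) : Prop :=
  exists (I : finType) (e : I -> V) (l : I -> {linear V -> R^o}),
    (forall i, continuous (l i)) /\ forall v, v = \sum_i l i v *: e i.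

Section Findim.
Context {R : realType}.
Implicit Types V W : normedModType R.

Lemma findim_row n : findim ('rV[R]_n).
Proof.
have lin (i : 'I_n) : linear (fun v : 'rV[R]_n => v 0 i : R^o).
  by move=> a u v; rewrite !mxE.
pose l i : {linear 'rV[R]_n -> R^o} :=
  HB.pack (fun v : 'rV[R]_n => v 0 i : R^o) (GRing.isLinear.Build _ _ _ _ _ (lin i)).
exists 'I_n, (fun i => delta_mx 0 i), l; split.
  by move=> i; exact: coord_continuous.
by move=> v; rewrite [LHS]row_sum_delta.
Qed.

Lemma findim_prod V W : findim V -> findim W -> findim (V * W)%type.
Proof.
move=> [I [e [l [cl el]]]] [J [e' [l' [cl' el']]]].
pose L (s : I + J) : {linear (V * W)%type -> R^o} :=
  match s with inl i => l i \o fst | inr j => l' j \o snd end.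
exists (I + J)%type,
  (fun s => match s with inl i => (e i, 0) | inr j => (0, e' j) end), L.
split=> [[i|j] x /=|[v w]].
- by apply: continuous_comp; [exact: cvg_fst|exact: cl].
- by apply: continuous_comp; [exact: cvg_snd|exact: cl'].
rewrite big_sumType/= [in LHS](el v) [in LHS](el' w).
have p1 (K : finType) (F : K -> V * W) : (\sum_k F k).1 = \sum_k (F k).1.
  exact: (raddf_sum fst).
have p2 (K : finType) (F : K -> V * W) : (\sum_k F k).2 = \sum_k (F k).2.
  exact: (raddf_sum snd).
apply/pair_equal_spec; split=> /=; rewrite ?p1 ?p2/=.
  by rewrite [X in _ + X]big1 ?addr0// => j _; rewrite scaler0.
by rewrite [X in X + _]big1 ?add0r// => j _; rewrite scaler0.
Qed.

(** By the chain rule d(g o f)(v) is the sum over a basis (e_i) of W of the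
    coordinates of df(v) times dg(e_i) o f.  Each factor is of class C^j as soon
    as f and g are of class C^(j+1), the second one by induction. *)
Lemma Ck_comp V W W' j (A : set V) (B : set W) (f : V -> W) (g : W -> W') :
  findim W -> open A -> open B -> (forall x, A x -> B (f x)) ->
  Ck j A f -> Ck j B g -> Ck j A (fun x => g (f x)).
Proof.
move=> [I [e [l [cl el]]]] oA oB AB.
elim: j f g AB => [|j IH] f g AB.
  by move=> Cf Cg x Ax; apply: (@continuous_comp _ _ _ f g); [exact: Cf|exact/Cg/AB].
move=> CSf [dg Cdg]; have [df Cdf] := CSf; split=> [x Ax|v].
  by apply: (@differentiable_comp _ _ _ _ f g); [exact: df|exact/dg/AB].
apply: (@Ck_ext _ _ _ _ _ (fun x => \sum_i l i ('d f x v) *: 'd g (f x) (e i))) => //.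
  move=> x Ax; rewrite (diff_comp_app _ (df _ Ax) (dg _ (AB _ Ax))).
  by rewrite [X in _ = 'd g (f x) X]el linear_sum; apply: eq_bigr => i _; rewrite linearZ.
apply: Ck_sum => // i; apply: CkZ => //; first exact: Ck_lin_comp oA (cl i) (Cdf v).
exact: (IH f (fun y => 'd g y (e i))) AB (CkS CSf) (Cdg (e i)).
Qed.

End Findim.

(** * Germs of smooth functions *)

Definition smooth_near (R : realType) (V W : normedModType R) (f : V -> W)
  (x : V) : Prop := exists A, [/\ open A, A x & smooth_on A f].

Section SmoothNear.
Context {R : realType}.
Implicit Types V W : normedModType R.

Lemma nearW_refl V W (u : V -> W) (y : V) : \forall z \near y, u z = u z.
Proof. exact: nearW. Qed.

Lemma near_open V (P : V -> Prop) x : (\forall z \near x, P z) ->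
  exists A, [/\ open A, A x & forall z, A z -> P z].
Proof.
move=> nP; have : nbhs x P by exact: nP.
by rewrite nbhsE => -[A [oA Ax] AP]; exists A.
Qed.

Lemma smooth_near_near V W (f : V -> W) x :
  smooth_near f x -> \forall z \near x, smooth_near f z.
Proof.
move=> [A [oA Ax sf]]; have nA : \forall z \near x, A z by exact: open_nbhs_nbhs.
by near=> z; exists A; split=> //; near: z.
Unshelve. all: by end_near. Qed.

Lemma smooth_near_diff V W (f : V -> W) x :
  smooth_near f x -> differentiable f x.
Proof. by move=> [A [oA Ax sf]]; have [df _] := sf 1%N; exact: df. Qed.

Lemma smooth_near_cts V W (f : V -> W) x :
  smooth_near f x -> {for x, continuous f}.
Proof. by move=> /smooth_near_diff/differentiable_continuous. Qed.

Lemma smooth_near_ext V W (f g : V -> W) x : (\forall z \near x, f z = g z) ->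
  smooth_near f x -> smooth_near g x.
Proof.
move=> /near_open [B [oB Bx Bfg]] [A [oA Ax sf]].
exists (A `&` B); split; [exact: openI|by []|].
move=> j; apply: (@Ck_ext _ _ _ _ _ f); first exact: openI.
  by move=> z [_ Bz]; exact: Bfg.
by apply: Ck_sub (sf j) => z [].
Qed.

Lemma smooth_near_derive V W (f : V -> W) x v :
  smooth_near f x -> smooth_near (fun z => 'd f z v) x.
Proof.
move=> [A [oA Ax sf]]; exists A; split=> // j.
by have [_ /(_ v)] := sf j.+1.
Qed.

Lemma smooth_near_cst V W (w : W) (x : V) : smooth_near (fun=> w) x.
Proof. by exists setT; split=> //; [exact: openT|move=> j; exact: Ck_cst]. Qed.

Lemma smooth_near_lin_comp V W W' (L : {linear W -> W'}) (f : V -> W) x :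
  continuous L -> smooth_near f x -> smooth_near (fun z => L (f z)) x.
Proof.
move=> cL [A [oA Ax sf]]; exists A; split=> // j.
exact: Ck_lin_comp (sf j).
Qed.

Lemma smooth_near_lin V W (L : {linear V -> W}) x :
  continuous L -> smooth_near L x.
Proof.
move=> cL; exists setT; split=> [||j]//; first exact: openT.
by apply: Ck_lin => //; exact: openT.
Qed.

Lemma smooth_nearD V W (f g : V -> W) x :
  smooth_near f x -> smooth_near g x -> smooth_near (fun z => f z + g z) x.
Proof.
move=> [A [oA Ax sf]] [B [oB Bx sg]]; exists (A `&` B).
split; [exact: openI|by []|move=> j].
by apply: CkD; [exact: openI|apply: Ck_sub (sf j) => ? []|apply: Ck_sub (sg j) => ? []].
Qed.

Lemma smooth_nearZ V W (k : V -> R^o) (f : V -> W) x :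
  smooth_near k x -> smooth_near f x -> smooth_near (fun z => k z *: f z) x.
Proof.
move=> [A [oA Ax sf]] [B [oB Bx sg]]; exists (A `&` B).
split; [exact: openI|by []|move=> j].
by apply: CkZ; [exact: openI|apply: Ck_sub (sf j) => ? []|apply: Ck_sub (sg j) => ? []].
Qed.

Lemma smooth_nearB V W (f g : V -> W) x :
  smooth_near f x -> smooth_near g x -> smooth_near (fun z => f z - g z) x.
Proof.
move=> sf sg; apply: smooth_near_ext
  (smooth_nearD sf (smooth_nearZ (smooth_near_cst (-1 : R^o) x) sg)).
by apply: nearW => z; rewrite scaleN1r.
Qed.

Lemma smooth_near_pair V W W' (f : V -> W) (g : V -> W') x :
  smooth_near f x -> smooth_near g x -> smooth_near (fun z => (f z, g z)) x.
Proof.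
move=> [A [oA Ax sf]] [B [oB Bx sg]]; exists (A `&` B).
split; [exact: openI|by []|move=> j].
by apply: Ck_pair; [apply: Ck_sub (sf j) => ? []|apply: Ck_sub (sg j) => ? []|exact: openI].
Qed.

Lemma smooth_near_snd V W W' (f : V -> W * W') x :
  smooth_near f x -> smooth_near (fun z => (f z).2) x.
Proof. by apply: (smooth_near_lin_comp (L := snd)) => z; exact: cvg_snd. Qed.

Lemma smooth_near_sum V W (I : finType) (f : I -> V -> W) x :
  (forall i, smooth_near (f i) x) -> smooth_near (fun z => \sum_i f i z) x.
Proof.
move=> sf; elim: (index_enum I) => [|i s IH].
  rewrite (_ : (fun _ => _) = fun=> 0); first exact: smooth_near_cst.
  by apply/funext => z; rewrite big_nil.
rewrite (_ : (fun _ => _) = fun z => f i z + \sum_(i <- s) f i z).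
  exact: smooth_nearD.
by apply/funext => z; rewrite big_cons.
Qed.

Lemma smooth_near_comp V W W' (f : V -> W) (g : W -> W') x : findim W ->
  smooth_near f x -> smooth_near g (f x) -> smooth_near (fun z => g (f z)) x.
Proof.
move=> fW sf [B [oB Bfx sg]]; have cf := smooth_near_cts sf.
case: sf => A [oA Ax sf].
have : \forall z \near x, B (f z) by apply: cf; exact: open_nbhs_nbhs.
move=> /near_open [C [oC Cx CB]].
exists (A `&` C); split; [exact: openI|by []|move=> j].
apply: (Ck_comp (A := A `&` C) (B := B) fW) => //.
- exact: openI.
- by move=> z [_ /CB].
- by apply: Ck_sub (sf j) => z [].
Qed.

(** In a basis (e_i) of V, df_z(g(z)) is the sum of the products of the
    coordinates of g(z) by the functions z |-> df_z(e_i), all of them smooth. *)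
Lemma smooth_near_diff_app V W (f : V -> W) (g : V -> V) x : findim V ->
  smooth_near f x -> smooth_near g x -> smooth_near (fun z => 'd f z (g z)) x.
Proof.
move=> [I [e [l [cl el]]]] sf sg.
have s : smooth_near (fun z => \sum_i (l i (g z) : R^o) *: 'd f z (e i)) x.
  apply: smooth_near_sum => i; apply: smooth_nearZ.
    exact: smooth_near_lin_comp.
  exact: smooth_near_derive.
apply: smooth_near_ext s; apply: nearW => z.
by rewrite [in RHS](el (g z)) linear_sum; apply: eq_bigr => i _; rewrite linearZ.
Qed.

Lemma diff_sum_app V W (I : finType) (f : I -> V -> W) x v :
  (forall i, differentiable (f i) x) ->
  differentiable (fun z => \sum_i f i z) x /\
  'd (fun z => \sum_i f i z) x v = \sum_i 'd (f i) x v.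
Proof.
move=> df; elim: (index_enum I) => [|i s [IHd IH]].
  have -> : (fun z => \sum_(i <- [::]) f i z) = cst 0.
    by apply/funext => z; rewrite big_nil.
  split; first exact: differentiable_cst.
  by rewrite diff_cst big_nil.
have -> : (fun z => \sum_(i <- i :: s) f i z) =
    fun z => f i z + \sum_(i <- s) f i z.
  by apply/funext => z; rewrite big_cons.
split; first exact: differentiableD.
by rewrite diffD_app// IH big_cons.
Qed.

(** Leibniz rule for the evaluation of df on a moving vector g(z), obtained
    coordinatewise in a basis. *)
Lemma diff_diff_app V W (f : V -> W) (g : V -> V) x w : findim V ->
  smooth_near f x -> smooth_near g x ->
  'd (fun z => 'd f z (g z)) x w =
  'd (fun z => 'd f z (g x)) x w + 'd f x ('d g x w).
Proof.
move=> [I [e [l [cl el]]]] sf sg.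
have dl i y : differentiable (l i) y by exact: linear_differentiable.
have dg := smooth_near_diff sg.
have E (h : V -> V) : smooth_near h x -> 'd (fun z => 'd f z (h z)) x w =
    \sum_i (l i (h x) *: 'd (fun z => 'd f z (e i)) x w +
            l i ('d h x w) *: 'd f x (e i)).
  move=> sh; have dh := smooth_near_diff sh.
  have -> : (fun z => 'd f z (h z)) = fun z => \sum_i l i (h z) *: 'd f z (e i).
    apply/funext => z; rewrite [in LHS](el (h z)) linear_sum.
    by apply: eq_bigr => i _; rewrite linearZ.
  have dfe i : differentiable (fun z => 'd f z (e i)) x.
    exact/smooth_near_diff/smooth_near_derive.
  have dlh i : differentiable (fun z => l i (h z)) x.
    exact: (differentiable_comp dh (dl i _)).
  have dlhf i := diff_scale (dlh i) (dfe i).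
  have [_ ->] := diff_sum_app w (fun i => (dlhf i).1).
  apply: eq_bigr => i _; rewrite (dlhf i).2 (diff_comp_app _ dh (dl i _)).
  by rewrite diff_lin.
rewrite !E//; last exact: smooth_near_cst.
rewrite (_ : 'd (fun=> g x) x w = 0); last by rewrite (diff_cst (g x)).
rewrite [in 'd f x _](el ('d g x w)) linear_sum -big_split/=.
apply: eq_bigr => i _.
by rewrite linear0 scale0r addr0 linearZ.
Qed.

Lemma MVT_line V (f : V -> R^o) p v (h : R) : 0 < h ->
  (forall s, 0 <= s <= h -> differentiable f (p + s *: v)) ->
  exists2 s, 0 < s < h & f (p + h *: v) - f p = h * 'd f (p + s *: v) v.
Proof.
move=> h0 df.
pose g (s : R) := f (p + s *: v) : R.
have dline (s : R) : differentiable (fun s : R^o => p + s *: v) s /\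
    'd (fun s : R^o => p + s *: v) s 1 = v.
  have dsv : differentiable (fun s : R^o => s *: v) s.
    exact: (differentiableZl (k := (id : R^o -> R)) v).
  have dc : differentiable (fun s : R^o => p) s by exact: differentiable_cst.
  split; first exact: differentiableD.
  rewrite diffD_app// (_ : 'd (fun=> p) s 1 = 0) ?add0r; last by rewrite (diff_cst p).
  have := diffZl (k := (id : R^o -> R)) v.
  move=> /(_ s) -> //=.
  by rewrite diff_val scale1r.
have dg (s : R) : 0 <= s <= h -> differentiable (g : R^o -> R^o) s /\
    is_derive s (1 : R^o) (g : R^o -> R^o) ('d f (p + s *: v) v).
  move=> sh; have [dl dlE] := dline s.
  have dgs : differentiable (g : R^o -> R^o) s.
    exact: (differentiable_comp dl (df _ sh)).
  split=> //; apply: DeriveDef; first exact: diff_derivable.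
  by rewrite deriveE// (diff_comp_app _ dl (df _ sh)) dlE.
have gc : {within `[0, h], continuous g}.
  apply: continuous_in_subspaceT => s; rewrite inE/= in_itv/= => sh.
  exact/differentiable_continuous/(dg s sh).1.
have gd s : s \in `]0, h[%R -> is_derive s 1 g ('d f (p + s *: v) v).
  by rewrite in_itv/= => /andP[s0 sh]; apply: (dg s _).2; rewrite !ltW.
have [s] := MVT h0 gd gc.
rewrite in_itv/= => sh; rewrite /g scale0r addr0 subr0 mulrC => E.
by exists s.
Qed.

Lemma diff_shift_app V W (f : V -> W) (a x v : V) : differentiable f (x + a) ->
  differentiable (fun z => f (z + a)) x /\
  'd (fun z => f (z + a)) x v = 'd f (x + a) v.
Proof.
move=> df; have di : differentiable (id : V -> V) x by [].
have dc : differentiable (fun=> a : V) x by exact: differentiable_cst.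
have ds : differentiable (fun z : V => z + a) x by exact: differentiableD.
split; first exact: (differentiable_comp ds df).
rewrite (diff_comp_app _ ds df) diffD_app//.
rewrite (_ : 'd (fun=> a) x v = 0) ?addr0; last by rewrite (diff_cst a).
by rewrite diff_val.
Qed.

(** Two mean values: along v for z |-> f(z + h w) - f(z), whose derivative is
    the increment of df(v) over h w, then along w for that increment. *)
Lemma second_difference V (f : V -> R^o) x v w (h : R) : 0 < h ->
  (forall s t, 0 <= s <= h -> 0 <= t <= h ->
     smooth_near f (x + s *: v + t *: w)) ->
  exists s t, [/\ 0 <= s <= h, 0 <= t <= h &
    f (x + h *: v + h *: w) - f (x + h *: v) - (f (x + h *: w) - f x) =
    h * (h * 'd (fun z => 'd f z v) (x + s *: v + t *: w) w)].
Proof.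
move=> h0 sf; have hh : 0 <= h <= h by rewrite lexx ltW.
have h00 : (0 : R) <= 0 <= h by rewrite lexx ltW.
pose g z := f (z + h *: w) - f z : R^o.
have dg s : 0 <= s <= h -> differentiable g (x + s *: v) /\
    'd g (x + s *: v) v = 'd f (x + s *: v + h *: w) v - 'd f (x + s *: v) v.
  move=> sh; have df1 := smooth_near_diff (sf s h sh hh).
  have := smooth_near_diff (sf s 0 sh h00); rewrite scale0r addr0 => df0.
  have [ds dsE] := diff_shift_app v df1.
  have dN : differentiable (fun z => - f z) (x + s *: v) by exact: differentiableN.
  split; first exact: differentiableD.
  rewrite diffD_app// dsE; congr (_ + _).
  by have := congr1 (fun k => k v) (diffN df0).
have [s /andP[s0 sh] E] := MVT_line h0 (fun s sh => (dg s sh).1).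
have {}sh : 0 <= s <= h by rewrite !ltW.
have dF t : 0 <= t <= h -> differentiable (fun z => 'd f z v) (x + s *: v + t *: w).
  by move=> th; apply/smooth_near_diff/smooth_near_derive/sf.
have [t /andP[t0 th] E'] := MVT_line h0 dF.
have {}th : 0 <= t <= h by rewrite !ltW.
exists s, t; split=> //.
rewrite -E' -(dg s sh).2 -E /g (addrAC x (h *: v)).
by rewrite opprB.
Qed.

(** The second difference of f over h v and h w is symmetric in v and w.  By
    [second_difference] it is h^2 times a value near x of each of the two
    iterated derivatives, which are continuous at x. *)
Lemma diff2_sym V (f : V -> R^o) x v w : smooth_near f x ->
  'd (fun z => 'd f z v) x w = 'd (fun z => 'd f z w) x v.
Proof.
move=> sf.
set G := fun z => 'd (fun z => 'd f z v) z w : R^o.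
set G' := fun z => 'd (fun z => 'd f z w) z v : R^o.
have cG : {for x, continuous G}.
  exact/smooth_near_cts/smooth_near_derive/smooth_near_derive.
have cG' : {for x, continuous G'}.
  exact/smooth_near_cts/smooth_near_derive/smooth_near_derive.
apply/eqP; rewrite -subr_eq0 -normr_le0; apply/ler_addgt0Pr => e e0; rewrite add0r.
have e2 : 0 < e / 2 by rewrite divr_gt0.
have nG : \forall z \near x, `|G x - G z| < e / 2.
  by move/cvgr_dist_lt : cG => /(_ _ e2).
have nG' : \forall z \near x, `|G' x - G' z| < e / 2.
  by move/cvgr_dist_lt : cG' => /(_ _ e2).
have : nbhs x (fun z => [/\ smooth_near f z, `|G x - G z| < e / 2 &
    `|G' x - G' z| < e / 2]).
  by have := smooth_near_near sf => nf; near=> z; split; near: z.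
move=> /nbhs_ballP[r /= r0 Hr].
(* The parallelogram spanned by h v and h w lies in the ball of radius r,
   even if v and w are both zero. *)
pose h := r / (2 * (1 + `|v| + `|w|)).
have d0 : 0 < 1 + `|v| + `|w| by rewrite -addrA ltr_wpDr// addr_ge0.
have h0 : 0 < h by rewrite divr_gt0// mulr_gt0.
have inb s t : 0 <= s <= h -> 0 <= t <= h -> ball x r (x + s *: v + t *: w).
  move=> /andP[s0 sh] /andP[t0 th].
  rewrite -ball_normE /= -addrA opprD addrA subrr add0r normrN.
  rewrite (le_lt_trans (ler_normD _ _))// !normrZ !ger0_norm//.
  apply: (@le_lt_trans _ _ (h * (1 + `|v| + `|w|))).
    have sv : s * `|v| <= h * `|v| by exact: ler_wpM2r.
    have tw : t * `|w| <= h * `|w| by exact: ler_wpM2r.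
    by rewrite !mulrDr mulr1; lra.
  rewrite /h invfM mulrA divfK ?gt_eqF//.
  by rewrite ltr_pdivrMr// mulr_natr mulr2n ltrDl.
have inr s t : 0 <= s <= h -> 0 <= t <= h ->
  smooth_near f (x + s *: v + t *: w) by move=> sh th; case: (Hr _ (inb s t sh th)).
have [s [t [sh th E]]] := second_difference h0 inr.
have [t' [s' [th' sh' E']]] := @second_difference V f x w v h h0
  (fun t s th sh => eq_ind _ (smooth_near f) (inr s t sh th) _ (addrAC _ _ _)).
have GE : G (x + s *: v + t *: w) = G' (x + s' *: v + t' *: w).
  rewrite /G /G' (addrAC x (s' *: v)).
  apply: (mulfI (lt0r_neq0 h0)); apply: (mulfI (lt0r_neq0 h0)).
  rewrite -E -E' (addrAC x (h *: w)).
  by rewrite !opprB !addrA; ring.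
have [_ H1 _] := Hr _ (inb _ _ sh th).
have [_ _ H2] := Hr _ (inb _ _ sh' th').
rewrite GE in H1.
rewrite -(subrKA (G' (x + s' *: v + t' *: w))) (le_trans (ler_normD _ _))//.
by rewrite (splitr e) lerD ?ltW// distrC.
Unshelve. all: by end_near. Qed.

Lemma derive1_line V (f : V -> R^o) (y v : V) : differentiable f y ->
  derive1 (fun s : R => f (y + s *: v) : R^o) 0 = 'd f y v.
Proof.
move=> df; rewrite -deriveE// /derive1 /derive.
rewrite (_ : (fun h : R => h^-1 *: _) =
  fun h : R => h^-1 *: (f (h *: v + y) - f y)) //.
by apply/funext => h; rewrite addr0 scale0r addr0 (addrC y).
Qed.

End SmoothNear.

(** * The coordinate expression of the Lie bracket *)

Section BracketRep.
Context {R : realType} {V : normedModType R}.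
Implicit Types (u v w : V -> V) (F : V -> R^o) (y : V).

Lemma diff_comb u v F y : smooth_near F y -> smooth_near u y -> smooth_near v y ->
  forall x, 'd (fun z => F z *: u z + v z) y x =
    F y *: 'd u y x + 'd F y x *: u y + 'd v y x.
Proof.
move=> /smooth_near_diff dF /smooth_near_diff du /smooth_near_diff dv x.
have [d dE] := diff_scale dF du.
by rewrite (diffD_app _ d dv) dE.
Qed.

Definition bracket_rep u v y : V := 'd v y (u y) - 'd u y (v y).

(** In d(F u + v)(w) the factor F is differentiated as well: hence the
    correction - dF(w) u, and + dF(w) u in the next lemma. *)
Lemma bracket_rep_combl u v w F y :
  smooth_near F y -> smooth_near u y -> smooth_near v y ->
  bracket_rep (fun z => F z *: u z + v z) w y =
  F y *: bracket_rep u w y + bracket_rep v w y - 'd F y (w y) *: u y.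
Proof.
move=> sF su sv; rewrite /bracket_rep scalerBr.
have E : 'd w y (F y *: u y + v y) = F y *: 'd w y (u y) + 'd w y (v y).
  exact: linearP.
have reorder (a b c d e : V) : a + b - (c + d + e) = a - c + (b - e) - d.
  by rewrite !opprD -!addrA; congr (a + _); rewrite (addrC (- e)) (addrCA b).
apply: etrans (reorder _ _ _ _ _).
exact: (congr2 (fun a b => a - b) E (diff_comb sF su sv _)).
Qed.

Lemma bracket_rep_combr u v w F y :
  smooth_near F y -> smooth_near u y -> smooth_near v y ->
  bracket_rep w (fun z => F z *: u z + v z) y =
  F y *: bracket_rep w u y + bracket_rep w v y + 'd F y (w y) *: u y.
Proof.
move=> sF su sv; rewrite /bracket_rep scalerBr.
have E : 'd w y (F y *: u y + v y) = F y *: 'd w y (u y) + 'd w y (v y).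
  exact: linearP.
have reorder (a b c d e : V) : c + d + e - (a + b) = c - a + (e - b) + d.
  by rewrite opprD -!addrA; congr (c + _); rewrite addrC -!addrA addrCA.
apply: etrans (reorder _ _ _ _ _).
exact: (congr2 (fun a b => a - b) (diff_comb sF su sv _) E).
Qed.

Lemma bracket_rep_eq u u' v v' y :
  (\forall z \near y, u z = u' z) -> (\forall z \near y, v z = v' z) ->
  smooth_near u y -> smooth_near v y ->
  bracket_rep u v y = bracket_rep u' v' y.
Proof.
move=> uu' vv' /smooth_near_diff du /smooth_near_diff dv; rewrite /bracket_rep.
rewrite (nbhs_singleton uu') (nbhs_singleton vv').
apply: (congr2 (fun a b => a - b)).
  by have [_ E] := near_eq_diff vv' dv; exact/esym/(congr1 (@^~ (u' y)) E).
by have [_ E] := near_eq_diff uu' du; exact/esym/(congr1 (@^~ (v' y)) E).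
Qed.

Lemma bracket_rep_smooth u v y : findim V ->
  smooth_near u y -> smooth_near v y -> smooth_near (bracket_rep u v) y.
Proof.
by move=> fV su sv; apply: smooth_nearB; exact: smooth_near_diff_app.
Qed.

End BracketRep.

(** * Smooth maps in charts *)

Section Charts.
Context {R : realType} {X : charted R}.
Context (hX : smooth_atlas X) (fX : findim (cmodel X)).
Implicit Types (c : chart X (cmodel X)) (p : X) (W : normedModType R).

Lemma cinvK c p : atlas c -> cdom c p -> cinv c (cfun c p) = p.
Proof. by move=> ac cp; exact: hX.1. Qed.

(** The statements that hold near p on the overlap of two charts, packaged
    together since the image of the overlap is open. *)
Lemma chart_near2 c c' p : atlas c -> atlas c' -> cdom c p -> cdom c' p ->
  \forall y \near cfun c p, [/\ cdom c (cinv c y), cdom c' (cinv c y),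
    cfun c (cinv c y) = y & smooth_near (cfun c' \o cinv c) y].
Proof.
move=> ac ac' cp c'p; have [oA sA] := hX.2 _ _ ac ac'.
have nA : \forall y \near cfun c p, (cfun c @` (cdom c `&` cdom c')) y.
  by apply: open_nbhs_nbhs; split=> //; exists p.
near=> y.
have Ay : (cfun c @` (cdom c `&` cdom c')) y by near: y.
have sy : smooth_near (cfun c' \o cinv c) y by exists (cfun c @` (cdom c `&` cdom c')).
by case: Ay => x [cx c'x] xy; move: sy; rewrite -xy cinvK.
Unshelve. all: by end_near. Qed.

Lemma chart_near c p : atlas c -> cdom c p ->
  \forall y \near cfun c p, cdom c (cinv c y) /\ cfun c (cinv c y) = y.
Proof.
by move=> ac cp; apply: filterS (chart_near2 ac ac cp cp) => y [].
Qed.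

Lemma transition_smooth c c' p : atlas c -> atlas c' -> cdom c p -> cdom c' p ->
  smooth_near (cfun c' \o cinv c) (cfun c p).
Proof.
by move=> ac ac' cp c'p; have [] := nbhs_singleton (chart_near2 ac ac' cp c'p).
Qed.

(** Smoothness of a germ need be checked in one chart only. *)
Lemma germ_change W c c' p (g : X -> W) :
  atlas c -> atlas c' -> cdom c p -> cdom c' p ->
  smooth_near (g \o cinv c) (cfun c p) -> smooth_near (g \o cinv c') (cfun c' p).
Proof.
move=> ac ac' cp c'p sg; have st := transition_smooth ac' ac c'p cp.
have : smooth_near (fun y => (g \o cinv c) ((cfun c \o cinv c') y)) (cfun c' p).
  by apply: smooth_near_comp => //=; rewrite cinvK.
apply: smooth_near_ext; apply: filterS (chart_near2 ac' ac c'p cp) => y [_ cy _ _].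
by rewrite /= cinvK.
Qed.

End Charts.

Lemma smooth_atW (R : realType) (X Y : charted R) (F : X -> Y) p c c' :
  smooth_at F p -> atlas c -> atlas c' -> cdom c p -> cdom c' (F p) ->
  (\forall y \near cfun c p, cdom c' (F (cinv c y))) /\
  smooth_near (cfun c' \o F \o cinv c) (cfun c p).
Proof.
move=> [_ sF] ac ac' cp c'p; have [A [oA Ap _ Ac' sA]] := sF _ _ ac ac' cp c'p.
split; last by exists A.
by have : nbhs (cfun c p) A by [exact: open_nbhs_nbhs]; apply: filterS => y /Ac'.
Qed.

Lemma smooth_atI (R : realType) (X Y : charted R) (F : X -> Y) p :
  smooth_atlas X -> carrier (F p) ->
  (forall c c', atlas c -> atlas c' -> cdom c p -> cdom c' (F p) ->
    (\forall y \near cfun c p, cdom c' (F (cinv c y))) /\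
    smooth_near (cfun c' \o F \o cinv c) (cfun c p)) ->
  smooth_at F p.
Proof.
move=> hX cFp H; split=> // c c' ac ac' cp c'p.
have [nc' [A [oA Ap sA]]] := H _ _ ac ac' cp c'p.
have nc := chart_near hX ac cp.
have : \forall y \near cfun c p, cdom c' (F (cinv c y)) /\
  (cdom c (cinv c y) /\ cfun c (cinv c y) = y) by near=> y; split; near: y.
move=> /near_open [B [oB Bp BP]].
exists (A `&` B); split=> //.
- exact: openI.
- by move=> y [_ /BP [_ [cy yE]]]; exists (cinv c y).
- by move=> y [_ /BP []].
- by move=> j; apply: Ck_sub (sA j) => y [].
Unshelve. all: by end_near. Qed.

(** One chart of Y at F p suffices to compose, so only the cancellation of the
    charts of Y is asked: for a tangent bundle this is [tangent_bundleK]. *)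
Lemma smooth_at_comp (R : realType) (X Y Z : charted R) (F : X -> Y)
    (G : Y -> Z) p : smooth_atlas X -> findim (cmodel Y) ->
  (forall c, atlas c -> forall q : Y, cdom c q -> cinv c (cfun c q) = q) ->
  smooth_at F p -> smooth_at G (F p) -> smooth_at (fun x => G (F x)) p.
Proof.
move=> hX fY YK sF sG; have [[c' ac' c'p] _] := sF.
apply: smooth_atI => //; first by case: sG.
move=> c c'' ac ac'' cp c''p.
have [nF sF'] := smooth_atW sF ac ac' cp c'p.
have [nG sG'] := smooth_atW sG ac' ac'' c'p c''p.
have cF : \forall y \near cfun c p, cdom c'' (G (cinv c' (cfun c' (F (cinv c y))))).
  have := smooth_near_cts sF'.
  rewrite /prop_for /continuous_at /= hX.1// => /(_ _ nG); exact.
split.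
  by apply: filterS2 nF cF => y /(YK _ ac') ->.
have : smooth_near
    (fun y => (cfun c'' \o G \o cinv c') ((cfun c' \o F \o cinv c) y)) (cfun c p).
  by apply: smooth_near_comp => //=; rewrite hX.1.
by apply: smooth_near_ext; apply: filterS nF => y /(YK _ ac') /= ->.
Qed.

Definition real_chart (R : realType) :
    chart (real_line R) (cmodel (real_line R)) := @Chart R R R^o setT id id.

(** * Tangent vectors and vector fields in charts *)

Section Tangent.
Context {R : realType} {X : charted R}.
Context (hX : smooth_atlas X) (fX : findim (cmodel X)).
Implicit Types (c : chart X (cmodel X)) (p : X) (W : normedModType R).

Lemma smooth_fun_atP c p (f : X -> R) : atlas c -> cdom c p ->
  smooth_fun_at f p <-> smooth_near (f \o cinv c : cmodel X -> R^o) (cfun c p).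
Proof.
move=> ac cp; split=> [sf|sf].
  have ar : @atlas R (real_line R) (real_chart R) by [].
  by have [_] := smooth_atW (Y := real_line R) sf ac ar cp I.
apply: smooth_atI => //; first by exists (real_chart R).
move=> c1 c' ac1 -> c1p _ /=; split; first exact: nearW.
exact: (germ_change hX fX ac ac1 cp c1p sf).
Qed.

Lemma smooth_fun_at_near c p (f : X -> R) : atlas c -> cdom c p ->
  smooth_fun_at f p -> \forall y \near cfun c p, smooth_fun_at f (cinv c y).
Proof.
move=> ac cp /(smooth_fun_atP _ ac cp)/smooth_near_near.
apply: filterS2 (chart_near hX ac cp) => y [cy yE] sf.
by apply/(smooth_fun_atP _ ac cy); rewrite yE.
Qed.

Lemma at_germsE p (v : tvec X) f : smooth_fun_at f p -> at_germs p v f = v f.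
Proof. by move=> sf; rewrite /at_germs; case: asboolP. Qed.

Lemma at_germs_eq p (v v' : tvec X) :
  (forall f, smooth_fun_at f p -> v f = v' f) -> at_germs p v = at_germs p v'.
Proof. by move=> vv'; apply/funext => f; rewrite /at_germs; case: asboolP => // /vv'. Qed.

Lemma coord_tvec_lin c p (r : R) w w' :
  coord_tvec c p (r *: w + w') = r *: coord_tvec c p w + coord_tvec c p w'.
Proof.
apply/funext => f; rewrite /coord_tvec /at_germs !fctE.
by case: asboolP => _; rewrite ?linearP// scaler0 addr0.
Qed.

(** A tangent vector is tested on the coordinate functions of the chart, whose
    germs are smooth. *)
Lemma coord_tvec_inj c p w w' : atlas c -> cdom c p ->
  coord_tvec c p w = coord_tvec c p w' -> w = w'.
Proof.
move=> ac cp ww'; have [I [e [l [cl el]]]] := fX.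
suff E i : l i w = l i w' by rewrite (el w) (el w'); apply: eq_bigr => i _; rewrite E.
pose f (x : X) := l i (cfun c x) : R.
have fE : \forall y \near cfun c p, (l i : cmodel X -> R^o) y = (f \o cinv c) y.
  by apply: filterS (chart_near hX ac cp) => y [_ yE]; rewrite /f /= yE.
have sl : smooth_near (l i) (cfun c p) by exact: smooth_near_lin.
have sf : smooth_fun_at f p by apply/(smooth_fun_atP _ ac cp); exact: smooth_near_ext fE sl.
have := congr1 (@^~ f) ww'; rewrite /coord_tvec !at_germsE//.
have [_ ->] := near_eq_diff fE (smooth_near_diff sl).
by rewrite diff_lin.
Qed.

(** The chain rule applied to f o c'^-1 = (f o c^-1) o (c o c'^-1). *)
Lemma coord_tvec_change c c' p w : atlas c -> atlas c' -> cdom c p -> cdom c' p ->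
  coord_tvec c' p w = coord_tvec c p ('d (cfun c \o cinv c') (cfun c' p) w).
Proof.
move=> ac ac' cp c'p; apply: at_germs_eq => f /(smooth_fun_atP _ ac cp) sf.
have st := transition_smooth hX ac' ac c'p cp.
have df := smooth_near_diff sf.
have E : (cfun c \o cinv c') (cfun c' p) = cfun c p by rewrite /= hX.1.
have dt := smooth_near_diff st.
have df' : differentiable (f \o cinv c : cmodel X -> R^o) ((cfun c \o cinv c') (cfun c' p)).
  by rewrite E.
have fE : \forall y \near cfun c' p,
    ((f \o cinv c) \o (cfun c \o cinv c')) y = (f \o cinv c') y :> R^o.
  by apply: filterS (chart_near2 hX ac' ac c'p cp) => y [_ cy _ _]; rewrite /= hX.1.
have [_ ->] := near_eq_diff fE (differentiable_comp dt df').
have /= -> := diff_comp_app w dt df'.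
by rewrite -[cfun c (cinv _ _)]/((cfun c \o cinv c') (cfun c' p)) E.
Qed.

Lemma tangent_coord c p v : atlas c -> cdom c p ->
  tangent p v <-> exists w, v = coord_tvec c p w.
Proof.
move=> ac cp; split=> [[c' [w [ac' c'p ->]]]|[w ->]]; last by exists c, w.
by eexists; exact: coord_tvec_change.
Qed.

Lemma tangent_coord_tvec c p w : atlas c -> cdom c p -> tangent p (coord_tvec c p w).
Proof. by move=> ac cp; exists c, w. Qed.

Lemma coord_tvecK c p w : atlas c -> cdom c p -> tcoord c p (coord_tvec c p w) = w.
Proof.
move=> ac cp; rewrite /tcoord; apply: coord_tvec_inj ac cp _.
exact: (@xgetPex _ 0 [set w' | coord_tvec c p w' = coord_tvec c p w]) (ex_intro _ w erefl).
Qed.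

Lemma tcoordK c p v : atlas c -> cdom c p -> tangent p v ->
  coord_tvec c p (tcoord c p v) = v.
Proof. by move=> ac cp /(tangent_coord _ ac cp) [w ->]; rewrite coord_tvecK. Qed.

Lemma tangent_lin p (r : R) (v v' : tvec X) : carrier p ->
  tangent p v -> tangent p v' -> tangent p (r *: v + v').
Proof.
move=> [c ac cp] /(tangent_coord _ ac cp) [w ->] /(tangent_coord _ ac cp) [w' ->].
by rewrite -coord_tvec_lin; exact: tangent_coord_tvec.
Qed.

Lemma tcoord_lin c p (r : R) (v v' : tvec X) : atlas c -> cdom c p ->
  tangent p v -> tangent p v' ->
  tcoord c p (r *: v + v') = r *: tcoord c p v + tcoord c p v'.
Proof.
move=> ac cp /(tangent_coord _ ac cp) [w ->] /(tangent_coord _ ac cp) [w' ->].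
by rewrite -coord_tvec_lin !coord_tvecK.
Qed.

Definition vf_rep c (U : X -> tvec X) (y : cmodel X) : cmodel X :=
  tcoord c (cinv c y) (U (cinv c y)).

Lemma vector_field_tangent U p : vector_field U -> carrier p -> tangent p (U p).
Proof. by move=> vU cp; have [[_ [c ac <-] [_ tp]] _] := vU p cp. Qed.

Lemma vector_field_rep U c p : vector_field U -> atlas c -> cdom c p ->
  smooth_near (vf_rep c U) (cfun c p).
Proof.
move=> vU ac cp; have Cp : carrier p by exists c.
have tp := vector_field_tangent vU Cp.
have ac' : @atlas _ (tangent_bundle X) (tangent_chart c) by exists c.
have [_ s] := smooth_atW (Y := tangent_bundle X) (vU p Cp) ac ac' cp (conj cp tp).
exact: (smooth_near_snd s).
Qed.

(** It is enough to use, for each chart, the coordinates of U in that same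
    chart; those with respect to another chart of the tangent bundle follow by
    a change of the source chart. *)
Lemma vector_fieldI U : (forall p, carrier p -> tangent p (U p)) ->
  (forall c p, atlas c -> cdom c p -> smooth_near (vf_rep c U) (cfun c p)) ->
  vector_field U.
Proof.
move=> tU sU p Cp; apply: smooth_atI => //.
  by have [c ac cp] := Cp; exists (tangent_chart c); [exists c|exact: (conj cp (tU p Cp))].
move=> c _ ac [c' ac' <-] cp [/= c'p _].
have nc := chart_near2 hX ac ac' cp c'p.
split.
  by apply: filterS nc => y [cy c'y _ _]; split=> //; apply: tU; exists c.
apply: smooth_near_pair; first exact: transition_smooth.
have := germ_change (g := fun q => tcoord c' q (U q)) hX fX ac' ac c'p cp.
by apply; exact: sU.
Qed.

Lemma vf_applyE U f c p : vector_field U -> smooth_fun_at f p ->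
  atlas c -> cdom c p -> 
  vf_apply U f p = 'd (f \o cinv c : cmodel X -> R^o) (cfun c p) (vf_rep c U (cfun c p)).
Proof.
move=> vU sf ac cp; have tp : tangent p (U p) by apply: vector_field_tangent => //; exists c.
rewrite /vf_apply -{1}(tcoordK ac cp tp) /coord_tvec at_germsE//.
by rewrite /vf_rep hX.1.
Qed.

Lemma vf_apply_near U f c p : vector_field U -> smooth_fun_at f p ->
  atlas c -> cdom c p -> \forall y \near cfun c p,
  'd (f \o cinv c : cmodel X -> R^o) y (vf_rep c U y) = (vf_apply U f \o cinv c) y.
Proof.
move=> vU sf ac cp.
apply: filterS2 (chart_near hX ac cp) (smooth_fun_at_near ac cp sf) => y [cy yE] sfy.
by rewrite /= (vf_applyE vU sfy ac cy) yE.
Qed.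

Lemma vf_apply_smooth U f p : vector_field U -> smooth_fun_at f p -> carrier p ->
  smooth_fun_at (vf_apply U f) p.
Proof.
move=> vU sf [c ac cp]; apply/(smooth_fun_atP _ ac cp).
apply: smooth_near_ext (vf_apply_near vU sf ac cp) _.
apply: smooth_near_diff_app => //; last exact: vector_field_rep.
exact/(smooth_fun_atP _ ac cp).
Qed.

(** With F the test function f in the chart, U(V f) is the derivative along u of
    z |-> dF_z(v(z)), that is d(dF(v))(u) + dF(dv(u)).  In the commutator the
    first terms cancel by symmetry of second derivatives. *)
Lemma lie_bracketE U V c p : vector_field U -> vector_field V ->
  atlas c -> cdom c p -> lie_bracket U V p =
  coord_tvec c p (bracket_rep (vf_rep c U) (vf_rep c V) (cfun c p)).
Proof.
move=> vU vV ac cp; apply: at_germs_eq => f sf; have Cp : carrier p by exists c.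
have sUf := vf_apply_smooth vU sf Cp; have sVf := vf_apply_smooth vV sf Cp.
rewrite -!/(vf_apply _ _ p) (vf_applyE vU sVf ac cp) (vf_applyE vV sUf ac cp).
move/(smooth_fun_atP _ ac cp) : (sf) => sF.
set F := f \o cinv c : cmodel X -> R^o in sF *.
set y0 := cfun c p in sF *.
have su := vector_field_rep vU ac cp; have sv := vector_field_rep vV ac cp.
have E (Z : X -> tvec X) (vZ : vector_field Z) w :
   'd (vf_apply Z f \o cinv c : cmodel X -> R^o) y0 w =
   'd (fun z => 'd F z (vf_rep c Z y0)) y0 w + 'd F y0 ('d (vf_rep c Z) y0 w).
  have sw := vector_field_rep vZ ac cp.
  have [_ ->] := near_eq_diff (vf_apply_near vZ sf ac cp)
     (smooth_near_diff (smooth_near_diff_app fX sF sw)).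
  exact: diff_diff_app.
apply: etrans (congr2 (fun r r' : R => r - r') (E V vV _) (E U vU _)) _.
apply: etrans (_ : 'd F y0 ('d (vf_rep c V) y0 (vf_rep c U y0)) -
  'd F y0 ('d (vf_rep c U) y0 (vf_rep c V y0)) = _); last exact/esym/linearB.
have cancel_second (r1 r2 r3 r4 : R) : r1 = r3 -> r1 + r2 - (r3 + r4) = r2 - r4.
  by move=> ->; rewrite opprD addrACA subrr add0r.
exact/cancel_second/diff2_sym.
Qed.

Lemma lie_bracket_vector_field (U V : X -> tvec X) : vector_field U -> vector_field V ->
  vector_field (lie_bracket U V).
Proof.
move=> vU vV; apply: vector_fieldI => [p [c ac cp]|c p ac cp].
  by rewrite (lie_bracketE vU vV ac cp); exact: tangent_coord_tvec.
have su := vector_field_rep vU ac cp; have sv := vector_field_rep vV ac cp.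
apply: smooth_near_ext (bracket_rep_smooth fX su sv).
apply: filterS (chart_near hX ac cp) => y [cy yE].
by rewrite [RHS]/vf_rep (lie_bracketE vU vV ac cy) coord_tvecK// yE.
Qed.

End Tangent.

Section VectorFieldAlgebra.
Context {R : realType} {X : charted R}.
Context (hX : smooth_atlas X) (fX : findim (cmodel X)).
Implicit Types (c : chart X (cmodel X)) (U V : X -> tvec X) (f : X -> R).

Lemma vf_rep_comb c p f U V : vector_field U -> vector_field V ->
  atlas c -> cdom c p -> \forall y \near cfun c p,
  vf_rep c (fun q => f q *: U q + V q) y =
  (f \o cinv c) y *: vf_rep c U y + vf_rep c V y.
Proof.
move=> vU vV ac cp; apply: filterS (chart_near hX ac cp) => y [cy _].
have Cy : carrier (cinv c y) by exists c.
by rewrite /vf_rep (tcoord_lin hX fX)//; apply: vector_field_tangent.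
Qed.

Lemma vector_field_comb f U V : smooth_fun f -> vector_field U -> vector_field V ->
  vector_field (fun q => f q *: U q + V q).
Proof.
move=> sf vU vV; apply: vector_fieldI => // [p Cp|c p ac cp].
  by apply: tangent_lin => //; apply: vector_field_tangent.
have Cp : carrier p by exists c.
have E := vf_rep_comb f vU vV ac cp.
apply: (@smooth_near_ext _ _ _
  (fun y => (f \o cinv c : _ -> R^o) y *: vf_rep c U y + vf_rep c V y)).
  by apply: filterS E => y ->.
apply: smooth_nearD; last exact: vector_field_rep.
apply: smooth_nearZ; last exact: vector_field_rep.
exact/(smooth_fun_atP hX fX _ ac cp)/sf.
Qed.

Lemma smooth_fun_cst (r : R) : smooth_fun (fun _ : X => r).
Proof.
move=> p [c ac cp]; apply/(smooth_fun_atP hX fX _ ac cp).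
exact: smooth_near_cst.
Qed.

Lemma smooth_funB f g : smooth_fun f -> smooth_fun g ->
  smooth_fun (fun p => f p - g p).
Proof.
move=> sf sg p Cp; have [c ac cp] := Cp; apply/(smooth_fun_atP hX fX _ ac cp).
by apply: smooth_nearB; apply/(smooth_fun_atP hX fX _ ac cp); [exact: sf|exact: sg].
Qed.

Lemma tangent_bundleK (d : chart (tangent_bundle X) (cmodel (tangent_bundle X))) :
  atlas d -> forall q, cdom d q -> cinv d (cfun d q) = q.
Proof.
move=> [c ac <-] [p v] [/= cp tv]; congr pair; first exact: hX.1.
by rewrite hX.1// (tcoordK hX fX).
Qed.

End VectorFieldAlgebra.

(** * Sections and vertical fields in bundle charts *)

Section Bundle.
Context {R : realType} {m k : nat} {M : manifold R m} {E : vbundle M k}.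
Notation TE := (total_space E).
Implicit Types (a : TE) (s : forall a : TE, fibre E (bproj a)).
Implicit Types (cM : chart M (cmodel M)) (t : trivialization (fibre E) k).

Lemma total_findim : findim (cmodel TE).
Proof. exact: findim_prod (findim_row m) (findim_row k). Qed.

Let hE : smooth_atlas TE := vb_smooth E.
Let fE := total_findim.

Lemma tfun_lin t a (r : R) (b b' : fibre E (bproj a)) : trivs t -> tdom t (bproj a) ->
  tfun t (r *: b + b') = r *: tfun t b + tfun t b'.
Proof. by move=> trt ta; have [l _ _] := vb_iso trt ta; exact: l. Qed.

Lemma tfunK t x (b : fibre E x) : trivs t -> tdom t x -> tinv t x (tfun t b) = b.
Proof. by move=> trt ta; have [_ l _] := vb_iso trt ta; exact: l. Qed.

Lemma tinvK t x w : trivs t -> tdom t x -> tfun t (tinv t x w) = w.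
Proof. by move=> trt ta; have [_ _ l] := vb_iso trt ta; exact: l. Qed.

Lemma tinv_lin t a (r : R) w w' : trivs t -> tdom t (bproj a) ->
  tinv t (bproj a) (r *: w + w') = r *: tinv t (bproj a) w + tinv t (bproj a) w'.
Proof.
move=> trt ta; rewrite -{1}(tinvK w trt ta) -{1}(tinvK w' trt ta) -tfun_lin//.
by rewrite tfunK.
Qed.

Lemma total_atlas cM t : atlas cM -> trivs t -> @atlas _ TE (total_chart cM t).
Proof. by move=> ac trt; exists cM, t. Qed.

Lemma total_cover a : exists (cM : chart M (cmodel M)) (t : trivialization (fibre E) k),
  [/\ @atlas R M cM, trivs t & cdom (total_chart (B := E) cM t) a].
Proof.
have [c ac ca] := mcover (tag a); have [t trt ta] := vb_cover E (tag a).
by exists c, t.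
Qed.

Lemma base_cover (x : M) : exists2 cM : chart M (cmodel M), @atlas R M cM & cdom cM x.
Proof. exact: mcover. Qed.

Lemma total_carrier a : carrier a.
Proof.
have [cM [t [ac trt ca]]] := total_cover a.
by exists (total_chart cM t); [exact: total_atlas|].
Qed.

(** In a bundle chart s |-> a + s b is a straight line, since the
    trivialization is linear on the fibre and the base point does not move. *)
Lemma vlift_coord cM t a (b : fibre E (bproj a)) : atlas cM -> trivs t ->
  cdom (total_chart (B := E) cM t) a ->
  vlift b = coord_tvec (X := TE) (total_chart cM t) a (0, tfun t b).
Proof.
move=> ac trt ca; have [cMa ta] := ca.
have aT := total_atlas ac trt.
apply: at_germs_eq => f /(smooth_fun_atP hE fE _ aT ca) sf.
rewrite -derive1_line; last exact: smooth_near_diff.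
congr derive1; apply/funext => r /=; congr f.
rewrite /= /bpoint -[cfun cM (tag a) + r *: 0]/(_ + _) scaler0 addr0.
rewrite (msmooth M).1//; congr (Tagged _ _).
have -> : tfun t (tagged a) + r *: tfun t b = tfun t (tagged a + r *: b).
  by rewrite addrC -(@tfun_lin t a)// addrC.
by rewrite tfunK.
Qed.

Lemma vlift_lin a (r : R) (b b' : fibre E (bproj a)) :
  vlift (r *: b + b') = r *: vlift b + vlift b'.
Proof.
have [_ [cM [t [ac trt ->]]] ca] := total_carrier a.
rewrite !(vlift_coord _ ac trt ca) -coord_tvec_lin tfun_lin//; last by case: ca.
congr coord_tvec; congr pair.
by rewrite /= scaler0 addr0.
Qed.

Lemma vlift_tangent a (b : fibre E (bproj a)) : tangent a (vlift b).
Proof.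
have [_ [cM [t [ac trt ->]]] ca] := total_carrier a.
by rewrite (vlift_coord b ac trt ca); apply: tangent_coord_tvec => //; exact: total_atlas.
Qed.

Definition pull_triv t : trivialization (fibre (pullback_self E)) k :=
  @Trivialization R TE (fun a => fibre E (bproj a)) k (@bproj R M k E @^-1` tdom t)
    (fun a => @tfun _ _ _ _ t (bproj a)) (fun a => @tinv _ _ _ _ t (bproj a)).

Definition sec_rep t s a : 'rV[R]_k := tfun t (s a).

Lemma section_rep s c t a : section (B := pullback_self E) s ->
  atlas c -> trivs t -> cdom c a -> tdom t (bproj a) ->
  smooth_near (sec_rep t s \o cinv c) (cfun c a).
Proof.
move=> ss ac trt ca ta.
have aT : @atlas _ (total_space (pullback_self E))
    (total_chart (B := pullback_self E) c (pull_triv t)).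
  by exists c, (pull_triv t); split=> //; exists t.
have [_ sm] := smooth_atW (ss a (total_carrier a)) ac aT ca (conj ca ta).
exact: (smooth_near_snd sm).
Qed.

Lemma sectionI s :
  (forall c t a, atlas c -> trivs t -> cdom c a -> tdom t (bproj a) ->
    smooth_near (sec_rep t s \o cinv c) (cfun c a)) ->
  section (B := pullback_self E) s.
Proof.
move=> H a _; apply: smooth_atI => //.
  have [cM [t [acM trt ca]]] := total_cover a.
  exists (total_chart (B := pullback_self E) (total_chart (B := E) cM t) (pull_triv t)).
    by exists (total_chart cM t), (pull_triv t); split=> //; [exact: total_atlas|exists t].
  by split; [exact: ca|exact: ca.2].
move=> c _ ac [c' [_ [ac' [t trt <-] ->]]] ca [/= c'a ta].
have [cM acM cMa] := base_cover (tag a).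
have aT := total_atlas acM trt.
have n1 := chart_near2 hE ac ac' ca c'a.
have n2 := chart_near2 hE ac aT ca (conj cMa ta).
split; first by apply: filterS2 n1 n2 => y [_ c'y _ _] [_ [_ ty] _ _].
apply: (@smooth_near_pair _ _ _ _ (cfun c' \o cinv c) (sec_rep t s \o cinv c)).
  exact: (transition_smooth hE ac ac' ca c'a).
exact: H.
Qed.

Lemma section_comb f s s' : smooth_fun f -> section (B := pullback_self E) s ->
  section (B := pullback_self E) s' ->
  section (B := pullback_self E) (fun a => f a *: s a + s' a).
Proof.
move=> sf ss ss'; apply: sectionI => c t a ac trt ca ta.
have [cM acM cMa] := base_cover (tag a).
have n2 := chart_near2 hE ac (total_atlas acM trt) ca (conj cMa ta).
apply: (@smooth_near_ext _ _ _ (fun y => (f \o cinv c : _ -> R^o) y *: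
  (sec_rep t s \o cinv c) y + (sec_rep t s' \o cinv c) y)).
  by apply: filterS n2 => y [_ [_ ty] _ _]; rewrite [RHS]/comp /sec_rep tfun_lin.
apply: smooth_nearD; last exact: section_rep.
apply: smooth_nearZ; last exact: section_rep.
exact/(smooth_fun_atP hE fE _ ac ca)/sf/total_carrier.
Qed.

Lemma vf_rep_vertical s cM t a : atlas cM -> trivs t ->
  cdom (total_chart (B := E) cM t) a ->
  \forall y \near cfun (total_chart (B := E) cM t) a,
  (0, (sec_rep t s \o cinv (total_chart (B := E) cM t)) y) =
  vf_rep (total_chart (B := E) cM t : chart TE (cmodel TE)) (vertical_field s) y.
Proof.
move=> ac trt ca; have aT := total_atlas ac trt.
apply: filterS (chart_near hE aT ca) => y [cy _].
rewrite [RHS]/vf_rep /vertical_field (vlift_coord _ ac trt cy).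
by rewrite (coord_tvecK hE fE).
Qed.

Lemma vertical_vector_field s : section (B := pullback_self E) s ->
  vector_field (vertical_field s).
Proof.
move=> ss; apply: vector_fieldI => // [a _|]; first exact: vlift_tangent.
move=> _ a [cM [t [ac trt ->]]] ca.
apply: smooth_near_ext (vf_rep_vertical s ac trt ca) _.
apply: smooth_near_pair; first exact: smooth_near_cst.
by apply: section_rep => //; [exact: total_atlas|case: ca].
Qed.

Context {H : connection E} (K : connector H).
Implicit Types (U V : TE -> tvec TE).

(** kappa U is the composite of the smooth maps U : E -> TE and kappa. *)
Lemma kappa_section U : vector_field U ->
  section (B := pullback_self E) (fun a => kappa K a (U a)).
Proof.
move=> vU a Ca.
apply: (smooth_at_comp (Y := tangent_bundle TE) (F := fun a => (a, U a))
  (G := fun aW => @bpoint R TE k (pullback_self E) aW.1 (kappa K aW.1 aW.2)) hE).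
- exact: findim_prod.
- exact: tangent_bundleK.
- exact: vU.
- by apply: kappa_smooth; have [] := vU a Ca.
Qed.

Lemma proj_H_comb f U V a : vector_field U -> vector_field V ->
  proj_H K a (f *: U a + V a) = f *: proj_H K a (U a) + proj_H K a (V a).
Proof.
move=> vU vV; have Ca := total_carrier a.
rewrite /proj_H /proj_V kappa_linear; [|exact: vector_field_tangent..].
by rewrite vlift_lin scalerBr opprD addrACA.
Qed.

(** P_H U is U minus the vertical field of the section kappa U. *)
Lemma proj_H_vector_field U : vector_field U ->
  vector_field (fun a => proj_H K a (U a)).
Proof.
move=> vU; have vK := vertical_vector_field (kappa_section vU).
have := vector_field_comb hE fE (smooth_fun_cst hE fE (-1)) vK vU.
rewrite (_ : (fun q => _) = (fun a => proj_H K a (U a)))//.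
by apply/funext => a; rewrite scaleN1r addrC.
Qed.

Lemma kappa_proj_H U a : vector_field U -> kappa K a (proj_H K a (U a)) = 0.
Proof.
move=> vU; rewrite /proj_H /proj_V addrC -scaleN1r kappa_linear.
- by rewrite kappa_vlift scaleN1r addNr.
- exact: vlift_tangent.
- exact/vector_field_tangent/total_carrier.
Qed.

End Bundle.

(** * The covariant derivative *)

Section Derivative.
Context {R : realType} {m k : nat} {M : manifold R m} {E : vbundle M k}.
Context {H : connection E} (K : connector H).
Notation TE := (total_space E).
Notation Sec := (section (B := pullback_self E)).
Implicit Types (a : TE) (s : forall a : TE, fibre E (bproj a)).
Implicit Types (cM : chart M (cmodel M)) (t : trivialization (fibre E) k).
Implicit Types (U V : TE -> tvec TE) (f : TE -> R).

Let hE : smooth_atlas TE := vb_smooth E.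
Let fE : findim (cmodel TE) := total_findim (E := E).

(** The chart [total_chart], seen in the type of the charts of the total space:
    the model is then found by unification. *)
Definition vb_chart cM t : chart TE (cmodel TE) := total_chart (B := E) cM t.

Definition kappa_coord c a (w : cmodel TE) : fibre E (bproj a) :=
  kappa K a (coord_tvec (X := TE) c a w).

Lemma kappa_coord_lin c a (r : R) w w' : atlas c -> cdom c a ->
  kappa_coord c a (r *: w + w') = r *: kappa_coord c a w + kappa_coord c a w'.
Proof.
by move=> ac ca; rewrite /kappa_coord coord_tvec_lin kappa_linear//;
   apply: tangent_coord_tvec.
Qed.

Lemma kappa_coord_vert cM t a w : atlas cM -> trivs t -> cdom (vb_chart cM t) a ->
  kappa_coord (vb_chart cM t) a (0, w) = tinv t (bproj a) w.
Proof.
move=> ac trt ca; rewrite /kappa_coord -{1}(tinvK w trt ca.2).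
by rewrite -(vlift_coord (a := a) _ ac trt ca) kappa_vlift.
Qed.

Definition local_sec cM t s (y : cmodel TE) : 'rV[R]_k := sec_rep t s (cinv (vb_chart cM t) y).

Definition horizontal U a := proj_H K a (U a).

Lemma local_sec_smooth cM t s a : Sec s -> atlas cM -> trivs t ->
  cdom (vb_chart cM t) a -> smooth_near (local_sec cM t s) (cfun (vb_chart cM t) a).
Proof.
by move=> ss ac trt ca; apply: section_rep => //; [exact: total_atlas|exact: ca.2].
Qed.

Lemma section_map_near cM t s a : atlas cM -> trivs t -> cdom (vb_chart cM t) a ->
  \forall y \near cfun (vb_chart cM t) a,
    cdom (vb_chart cM t) (section_map s (cinv (vb_chart cM t) y)) /\
    cfun (vb_chart cM t) (section_map s (cinv (vb_chart cM t) y)) = (y.1, local_sec cM t s y).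
Proof.
move=> ac trt ca; apply: filterS (chart_near hE (total_atlas ac trt) ca) => y [cy yE].
by split=> //; congr pair; rewrite -[in RHS]yE.
Qed.

(** In the chart sigma is the map T : (x, e) |-> (x, S(x, e)), whose differential
    sends (0, b) to (0, dS(0, b)). *)
Lemma diff_local_sec cM t s a g b : Sec s -> atlas cM -> trivs t ->
  cdom (vb_chart cM t) a -> smooth_fun_at g (section_map s a) ->
  let c := vb_chart cM t in let y := cfun c a in
  smooth_fun_at (g \o section_map s) a /\
  'd (g \o section_map s \o cinv c : cmodel TE -> R^o) y (0, b) =
  'd (g \o cinv c : cmodel TE -> R^o) (cfun c (section_map s a))
    (0, 'd (local_sec cM t s) y (0, b)).
Proof.
move=> ss ac trt ca sg c y; have aT := total_atlas ac trt.
have nE := section_map_near s ac trt ca.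
have [cs csE] := nbhs_singleton nE.
rewrite hE.1// in cs csE.
pose T (z : cmodel TE) := (z.1, local_sec cM t s z) : cmodel TE.
have TyE : T y = cfun c (section_map s a) by exact: esym csE.
have ss' := local_sec_smooth ss ac trt ca.
have sT : smooth_near T y.
  apply: smooth_near_pair ss'.
  by apply: (smooth_near_lin (L := fst)) => z; exact: cvg_fst.
have sG : smooth_near (g \o cinv c : cmodel TE -> R^o) (T y).
  by rewrite TyE; apply/(smooth_fun_atP hE fE _ aT cs).
have gT : \forall z \near y, (g \o cinv c) (T z) = (g \o section_map s \o cinv c) z :> R^o.
  by apply: filterS nE => z [cz zE]; rewrite /comp /T -zE hE.1.
have sGT := smooth_near_comp fE sT sG.
split; first by apply/(smooth_fun_atP hE fE _ aT ca); exact: smooth_near_ext gT sGT.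
have dT := smooth_near_diff sT; have dG := smooth_near_diff sG.
have [_ E'] := near_eq_diff gT (smooth_near_diff sGT).
apply: etrans (congr1 (@^~ (0, b)) E') _.
apply: etrans (diff_comp_app _ dT dG) _.
rewrite TyE; congr ('d _ _ _).
have d1 : differentiable (fst : cmodel TE -> _) y.
  by apply: linear_differentiable => z; exact: cvg_fst.
apply: etrans (congr1 (@^~ (0, b)) (diff_pair d1 (smooth_near_diff ss'))) _.
congr pair.
have := @diff_lin R _ _ (fst : {linear cmodel TE -> _}) y.
by move=> -> // z; exact: cvg_fst.
Qed.

(** T sigma maps the vertical lift of b at a to the vertical lift, at sigma(a),
    of the derivative of sigma along the fibre. *)
Lemma kappa_tangent_map cM t s a (b : fibre E (bproj a)) : Sec s -> atlas cM -> trivs t ->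
  cdom (vb_chart cM t) a ->
  kappa K (section_map s a) (tangent_map (section_map s) a (vlift b)) =
  tinv t (bproj a) ('d (local_sec cM t s) (cfun (vb_chart cM t) a) (0, tfun t b)).
Proof.
move=> ss ac trt ca; have aT := total_atlas ac trt.
set w := 'd _ _ _.
have cs : cdom (vb_chart cM t) (section_map s a) by [].
have <- : vlift (a := section_map s a) (tinv t (bproj a) w) =
    tangent_map (section_map s) a (vlift b).
  rewrite (vlift_coord _ ac trt cs) tinvK//; last exact: ca.2.
  apply: at_germs_eq => g sg.
  have [sgs dgs] := diff_local_sec (tfun t b) ss ac trt ca sg.
  by rewrite (vlift_coord _ ac trt ca) /coord_tvec at_germsE.
exact: kappa_vlift.
Qed.

Lemma cov_D_coord cM t U s a : vector_field U -> Sec s -> atlas cM -> trivs t ->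
  cdom (vb_chart cM t) a ->
  let c := vb_chart cM t in let y := cfun c a in
  cov_D K U s a =
    kappa_coord c a (bracket_rep (vf_rep c (horizontal U))
                      (fun z => (0, local_sec cM t s z)) y) +
    tinv t (bproj a) ('d (local_sec cM t s) y (0, tfun t (kappa K a (U a)))).
Proof.
move=> vU ss ac trt ca c y; have aT := total_atlas ac trt.
rewrite /cov_D (kappa_tangent_map _ ss ac trt ca); congr (_ + _).
have vH := proj_H_vector_field K vU; have vV := vertical_vector_field ss.
rewrite /kappa_coord (lie_bracketE hE fE vH vV aT ca); congr (kappa _ _ (coord_tvec _ _ _)).
apply/esym/bracket_rep_eq.
- exact: nearW_refl.
- exact: (vf_rep_vertical s ac trt ca).
- exact: vector_field_rep.
- apply: smooth_near_pair; first exact: smooth_near_cst.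
  exact: local_sec_smooth.
Qed.

Lemma local_sec_comb cM t f s s' a : atlas cM -> trivs t -> cdom (vb_chart cM t) a ->
  \forall y \near cfun (vb_chart cM t) a,
    (f \o cinv (vb_chart cM t)) y *: local_sec cM t s y + local_sec cM t s' y =
    local_sec cM t (fun a => f a *: s a + s' a) y.
Proof.
move=> ac trt ca; apply: filterS (chart_near hE (total_atlas ac trt) ca) => y [cy _].
by rewrite [RHS]/local_sec /sec_rep tfun_lin//; exact: cy.2.
Qed.

(** The first summand is kappa of the smooth field [P_H U, sigma^V]; the second
    is locally the derivative of S along the smooth field (0, kappa U). *)
Lemma cov_D_section U s : vector_field U -> Sec s -> Sec (cov_D K U s).
Proof.
move=> vU ss.
have s1 : Sec (fun a => kappa K a (lie_bracket (horizontal U) (vertical_field s) a)).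
  apply: kappa_section; apply: lie_bracket_vector_field => //.
    exact: proj_H_vector_field.
  exact: vertical_vector_field.
suff s2 : Sec (fun a => kappa K (section_map s a)
    (tangent_map (section_map s) a (proj_V K a (U a)))).
  have := section_comb (smooth_fun_cst hE fE 1) s1 s2.
  by congr section; apply: functional_extensionality_dep => a; rewrite scale1r.
apply: sectionI => c t a ac trt ca ta.
have [cM acM cMa] := base_cover (tag a); have ca' : cdom (vb_chart cM t) a by [].
have aT := total_atlas acM trt.
apply: (germ_change hE fE aT ac ca' ca).
have sk := local_sec_smooth (kappa_section K vU) acM trt ca'.
have ss' := local_sec_smooth ss acM trt ca'.
apply: smooth_near_ext (smooth_near_diff_app fE ss'
  (smooth_near_pair (smooth_near_cst (0 : 'rV[R]_m) _) sk)).
apply: filterS (chart_near hE aT ca') => y [cy yE].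
set a' := cinv _ y in cy yE.
have := kappa_tangent_map (kappa K a' (U a')) ss acM trt cy.
move=> /(congr1 (@tfun _ _ _ _ t (bproj a'))) /esym; apply: etrans.
by rewrite tinvK; [rewrite yE| |exact: cy.2].
Qed.

(** Linearity over functions and additivity in U in one formula.  The
    correction term of [bracket_rep_combl] is a multiple of P_H U, which kappa
    kills. *)
Lemma cov_D_combl f U V s a : smooth_fun f -> vector_field U -> vector_field V ->
  Sec s ->
  cov_D K (fun p => f p *: U p + V p) s a = f a *: cov_D K U s a + cov_D K V s a.
Proof.
move=> sf vU vV ss; have [cM [t [ac trt ca]]] := total_cover a.
have aT := total_atlas ac trt; have ta := ca.2.
have vUV := vector_field_comb hE fE sf vU vV.
rewrite !(cov_D_coord _ ss ac trt ca)//.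
set c := vb_chart cM t; set y := cfun c a; set S := local_sec cM t s.
have vHU := proj_H_vector_field K vU; have vHV := proj_H_vector_field K vV.
have su := vector_field_rep vHU aT ca; have sv := vector_field_rep vHV aT ca.
have sF : smooth_near (f \o cinv c : cmodel TE -> R^o) y.
  exact/(smooth_fun_atP hE fE _ aT ca)/sf/total_carrier.
have sS : smooth_near (fun z => (0, S z) : cmodel TE) y.
  by apply: smooth_near_pair; [exact: smooth_near_cst|exact: local_sec_smooth].
have HE : horizontal (fun p => f p *: U p + V p) =
    (fun p => f p *: horizontal U p + horizontal V p).
  by apply/funext => p; rewrite /horizontal (proj_H_comb _ (f p) p vU vV).
have EB : bracket_rep (vf_rep c (horizontal (fun p => f p *: U p + V p)))
    (fun z => (0, S z)) y =
  f a *: bracket_rep (vf_rep c (horizontal U)) (fun z => (0, S z)) y +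
  bracket_rep (vf_rep c (horizontal V)) (fun z => (0, S z)) y -
  'd (f \o cinv c : cmodel TE -> R^o) y (0, S y) *: vf_rep c (horizontal U) y.
  have fa : f a = (f \o cinv c) y by rewrite /comp /y hE.1.
  rewrite fa HE -(bracket_rep_combl _ sF su sv).
  apply: bracket_rep_eq => //; last first.
    by apply: vector_field_rep => //; apply: vector_field_comb.
    exact: nearW_refl.
  exact: vf_rep_comb.
have kH : kappa_coord c a (vf_rep c (horizontal U) y) = 0.
  rewrite /kappa_coord /vf_rep /y hE.1// (tcoordK hE fE)//; first exact: kappa_proj_H.
  exact/vector_field_tangent/total_carrier.
have kl r w w' : kappa_coord c a (r *: w + w') =
    r *: kappa_coord c a w + kappa_coord c a w' by exact: kappa_coord_lin.
have kN w d : kappa_coord c a (w - d *: vf_rep c (horizontal U) y) = kappa_coord c a w.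
  by rewrite addrC -scaleNr kl kH scaler0 add0r.
apply: etrans (congr1 (fun w => kappa_coord c a w + tinv t (bproj a) _) EB) _.
rewrite kN kl scalerDr addrACA; congr (_ + _).
rewrite -tinv_lin//; congr (tinv _ _ _).
rewrite kappa_linear; [|exact/vector_field_tangent/total_carrier..].
rewrite tfun_lin// -linearP; congr ('d _ _ _).
by congr pair; rewrite /= scaler0 addr0.
Qed.

(** The Leibniz rule and additivity in sigma in one formula: the bracket
    contributes the derivative of f along P_H U, the second summand the one
    along P_V U. *)
Lemma cov_D_combr f U s s' a : smooth_fun f -> vector_field U -> Sec s -> Sec s' ->
  cov_D K U (fun p => f p *: s p + s' p) a =
  vf_apply U f a *: s a + f a *: cov_D K U s a + cov_D K U s' a.
Proof.
move=> sf vU ss ss'; have [cM [t [ac trt ca]]] := total_cover a.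
have aT := total_atlas ac trt; have ta := ca.2.
have sss := section_comb sf ss ss'.
rewrite (cov_D_coord vU sss ac trt ca) (cov_D_coord vU ss ac trt ca).
rewrite (cov_D_coord vU ss' ac trt ca).
set c := vb_chart cM t; set y := cfun c a.
set S := local_sec cM t s; set S' := local_sec cM t s'.
have vHU := proj_H_vector_field K vU; have su := vector_field_rep vHU aT ca.
have sF : smooth_near (f \o cinv c : cmodel TE -> R^o) y.
  exact/(smooth_fun_atP hE fE _ aT ca)/sf/total_carrier.
set F := (f \o cinv c : cmodel TE -> R^o) in sF *.
have sS : smooth_near S y by exact: local_sec_smooth.
have sS' : smooth_near S' y by exact: local_sec_smooth.
have vert (T : cmodel TE -> 'rV[R]_k) : smooth_near T y ->
    smooth_near (fun z => (0, T z) : cmodel TE) y.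
  by apply: smooth_near_pair; exact: smooth_near_cst.
have SE : \forall z \near y, F z *: S z + S' z =
    local_sec cM t (fun p => f p *: s p + s' p) z by exact: local_sec_comb.
have fa : f a = F y by rewrite /F /comp /y hE.1.
have Sa : tinv t (bproj a) (S y) = s a by rewrite /S /local_sec /y hE.1// tfunK.
have uH : kappa_coord c a (0, S y) = s a by rewrite kappa_coord_vert.
set b := tfun t (kappa K a (U a)).
set u := vf_rep c (horizontal U).
have {}su : smooth_near u y by [].
have EB : bracket_rep u (fun z => (0, local_sec cM t (fun p => f p *: s p + s' p) z)) y =
  F y *: bracket_rep u (fun z => (0, S z)) y + bracket_rep u (fun z => (0, S' z)) y +
  'd F y (u y) *: (0, S y).
  rewrite -(bracket_rep_combr u sF (vert _ sS) (vert _ sS')).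
  apply/esym/bracket_rep_eq => //; first exact: nearW_refl.
    apply: filterS SE => z <-; congr pair.
    by rewrite /= scaler0 addr0.
  apply: smooth_nearD; last exact: vert.
  by apply: smooth_nearZ => //; exact: vert.
have ED : 'd (local_sec cM t (fun p => f p *: s p + s' p)) y (0, b) =
    F y *: 'd S y (0, b) + ('d F y (0, b) *: S y + 'd S' y (0, b)).
  have [dFS dFSE] := diff_scale (smooth_near_diff sF) (smooth_near_diff sS).
  have dS' := smooth_near_diff sS'.
  have [_ dE] := near_eq_diff SE (differentiableD dFS dS').
  apply: etrans (congr1 (@^~ (0, b)) dE) _.
  apply: etrans (diffD_app _ dFS dS') _.
  apply: etrans (congr1 (+%R^~ ('d S' y (0, b))) (dFSE (0, b))) _.
  exact/esym/addrA.
have UE : vf_apply U f a = 'd F y (u y) + 'd F y (0, b).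
  have Ca := total_carrier a; have tU := vector_field_tangent vU Ca.
  rewrite (vf_applyE hE fE vU (sf _ Ca) aT ca); apply: etrans (linearD _ _ _).
  congr ('d _ _ _); rewrite /u /vf_rep /y hE.1//.
  rewrite /horizontal /proj_H /proj_V (vlift_coord _ ac trt ca).
  have [w Uw] := (tangent_coord hE fE _ aT ca).1 tU.
  have -> : U a - coord_tvec (X := TE) (total_chart cM t) a (0, b) =
      coord_tvec (X := TE) c a (w - (0, b)).
    by rewrite Uw addrC -scaleN1r -coord_tvec_lin scaleN1r addrC.
  by rewrite Uw !(coord_tvecK hE fE)// subrK.
have kl r w w' : kappa_coord c a (r *: w + w') =
    r *: kappa_coord c a w + kappa_coord c a w' by exact: kappa_coord_lin.
have tl r w w' : tinv t (bproj a) (r *: w + w') =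
  r *: tinv t (bproj a) w + tinv t (bproj a) w' by exact: tinv_lin.
have klD r w1 w2 x : kappa_coord c a (r *: w1 + w2 + x *: (0, S y)) =
    r *: kappa_coord c a w1 + (x *: s a + kappa_coord c a w2).
  by rewrite -addrA kl (addrC w2) kl uH.
apply: etrans (congr2 (fun w d => kappa_coord c a w + tinv t (bproj a) d) EB ED) _.
rewrite klD !tl Sa UE fa scalerDl scalerDr.
have reorder (W : zmodType) (w1 w2 w3 w4 w5 w6 : W) :
    w1 + (w2 + w3) + (w4 + (w5 + w6)) = w2 + w5 + (w1 + w4) + (w3 + w6).
  by rewrite addrACA (addrACA w2) addrA (addrC (w1 + w4)).
exact: reorder.
Qed.

Lemma vf_apply_subr1 f U a : smooth_fun f -> vector_field U ->
  vf_apply U (fun p => f p - 1) a = vf_apply U f a.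
Proof.
move=> sf vU; have [cM [t [ac trt ca]]] := total_cover a.
have aT := total_atlas ac trt; have Ca := total_carrier a.
have s1 := smooth_fun_cst hE fE (1 : R).
rewrite (vf_applyE hE fE vU (smooth_funB hE fE sf s1 Ca) aT ca).
rewrite (vf_applyE hE fE vU (sf _ Ca) aT ca).
have dF := smooth_near_diff ((smooth_fun_atP hE fE _ aT ca).1 (sf _ Ca)).
have d1 := smooth_near_diff (smooth_near_cst (-1 : R^o) (cfun (vb_chart cM t) a)).
apply: etrans (diffD_app _ dF d1) _.
apply: etrans (congr1 (+%R _) (congr1 (@^~ _) (diff_cst (-1 : R^o) _))) _.
exact: addr0.
Qed.

Lemma vf_apply_cst (r : R) U a : vector_field U -> vf_apply U (fun=> r) a = 0.
Proof.
move=> vU; have [cM [t [ac trt ca]]] := total_cover a.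
have Ca := total_carrier a.
rewrite (vf_applyE hE fE vU (smooth_fun_cst hE fE r Ca) (total_atlas ac trt) ca).
exact: (congr1 (@^~ _) (diff_cst (r : R^o) _)).
Qed.

End Derivative.

Theorem theorem3p1 (R : realType) (m k : nat) (M : manifold R m)
    (E : vbundle M k) (H : connection E) (K : connector H) :
  covariant_derivative (B := pullback_self E) (@cov_D R m M k E H K).
Proof.
have hE : smooth_atlas (total_space E) := vb_smooth E.
have fE : findim (cmodel (total_space E)) := total_findim (E := E).
have s1 := smooth_fun_cst hE fE (1 : R).
split.
- exact: cov_D_section.
- by move=> r U V s vU vV ss a; apply: (cov_D_combl K a (smooth_fun_cst hE fE r)).
- move=> r U s t vU ss st a.
  have := cov_D_combr K a (smooth_fun_cst hE fE r) vU ss st.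
  by rewrite (vf_apply_cst r a vU) scale0r add0r.
- move=> f U s sf vU ss a.
  (* Writing f = (f - 1) + 1 makes [cov_D_combl] apply with V = U. *)
  have fUE : (fun p => f p *: U p) = (fun p => (f p - 1) *: U p + U p).
    by apply/funext => p; rewrite scalerBl scale1r subrK.
  rewrite fUE; apply: etrans (cov_D_combl K a (smooth_funB hE fE sf s1) vU vU ss) _.
  by rewrite scalerBl scale1r subrK.
- move=> f U s sf vU ss a.
  (* Likewise, with the second section equal to the first. *)
  have fsE : (fun p => f p *: s p) = (fun p => (f p - 1) *: s p + s p).
    by apply: functional_extensionality_dep => p; rewrite scalerBl scale1r subrK.
  rewrite fsE; apply: etrans (cov_D_combr K a (smooth_funB hE fE sf s1) vU ss ss) _.
  by rewrite (vf_apply_subr1 a sf vU) scalerBl scale1r -addrA subrK.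
Qed.
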